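(* Let $E,F$ be finite, essential, strongly connected graphs satisfying Condition (L), and let $R$ be a unital subring of $\mathbb C$ closed under complex conjugation. Assume every projection of $L_R(F)$ lies in $\mathcal D(L_R(F))$. If $L_R(E)$ is $*$-isomorphic to $L_R(F)$, then $\operatorname{sgn}(\det(I-A_E))=\operatorname{sgn}(\det(I-A_F))$.
   Context: A graph $E=(E^0,E^1,r,s)$ has vertices $E^0$, edges $E^1$, and range and source maps $r,s$. A path is a word $e_1\cdots e_n$ with $r(e_i)=s(e_{i+1})$; vertices are paths of length $0$; $E^*$ is the set of finite paths. The adjacency matrix $A_E$ is the $E^0\times E^0$ matrix with $A_E(v,w)=|s^{-1}(v)\cap r^{-1}(w)|$. $E$ is strongly connected if there is a path between any two vertices; essential if it has no sinks or sources; and satisfies Condition (L) if every cycle has an exit. The Leavitt path algebra $L_R(E)$ is the universal $R$-algebra generated by pairwise orthogonal idempotents $\{v\}_{v\in E^0}$ and $\{e,e^*\}_{e\in E^1}$ with: $e^*f=0$ for $e\ne f$; $e^*e=r(e)$; $s(e)e=e=er(e)$; $e^*s(e)=e^*=r(e)e^*$; and $v=\sum_{e\in s^{-1}(v)}ee^*$ whenever $s^{-1}(v)$ is finite and nonempty. For $\alpha=e_1\cdots e_n$ put $\alpha^*=e_n^*\cdots e_1^*$. $L_R(E)$ carries the conjugate-linear involution $(\lambda\alpha\beta^* )^*=\overline\lambda\beta\alpha^*$. A projection is an element $p$ with $p=p^2=p^*$. The diagonal is $\mathcal D(L_R(E))=\mathrm{span}_R\{\alpha\alpha^*\mid\alpha\in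 E^*\}$. *)

(* Defs.v *)
From Stdlib Require Rdefinitions.
From HB Require Import structures.
From mathcomp Require Import all_boot all_order all_algebra.

Set Implicit Arguments.
Unset Strict Implicit.
Unset Printing Implicit Defensive.

Import GRing.Theory Num.Theory.
Local Open Scope ring_scope.

Record cpx := Cpx { cre : Rdefinitions.R ; cim : Rdefinitions.R }.

Definition cpx0 : cpx := Cpx Rdefinitions.R0 Rdefinitions.R0.
Definition cpx1 : cpx := Cpx Rdefinitions.R1 Rdefinitions.R0.
Definition cpx_add (z w : cpx) : cpx :=
  Cpx (Rdefinitions.Rplus (cre z) (cre w)) (Rdefinitions.Rplus (cim z) (cim w)).
Definition cpx_mul (z w : cpx) : cpx :=
  Cpx (Rdefinitions.Rplus (Rdefinitions.Rmult (cre z) (cre w))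
                          (Rdefinitions.Ropp (Rdefinitions.Rmult (cim z) (cim w))))
      (Rdefinitions.Rplus (Rdefinitions.Rmult (cre z) (cim w))
                          (Rdefinitions.Rmult (cim z) (cre w))).
Definition cpx_conj (z : cpx) : cpx := Cpx (cre z) (Rdefinitions.Ropp (cim z)).

(* A unital subring of C closed under complex conjugation, presented as a   *)
(* commutative ring [R] together with an injective unital ring embedding    *)
(* [iota : R -> C] whose image is closed under conjugation; [conjR] is the   *)
(* conjugation transported to R (uniquely determined by [iota] injective).  *)
Definition conj_closed_subring_of_C (R : comNzRingType) (iota : R -> cpx)
    (conjR : R -> R) : Prop :=
  [/\ injective iota,
      iota 1 = cpx1,
      (forall x y, iota (x + y) = cpx_add (iota x) (iota y)),
      (forall x y, iota (x * y) = cpx_mul (iota x) (iota y)) &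
      (forall x, iota (conjR x) = cpx_conj (iota x))].

Record graph := Graph {
  nV : nat;
  edge : finType;
  src : edge -> 'I_nV;
  rng : edge -> 'I_nV }.
Arguments src {g} _.
Arguments rng {g} _.

Definition adjacency (E : graph) : 'M[int]_(nV E) :=
  \matrix_(v, w) (#|[pred e : edge E | (src e == v) && (rng e == w)]|)%:Z.

Definition edge_rel (E : graph) : rel 'I_(nV E) :=
  fun v w => [exists e : edge E, (src e == v) && (rng e == w)].

Definition strongly_connected (E : graph) : Prop :=
  forall v w : 'I_(nV E), connect (@edge_rel E) v w.

Definition essential (E : graph) : Prop :=
  forall v : 'I_(nV E),
    (exists e : edge E, src e = v) /\ (exists e : edge E, rng e = v).

Definition succ_edge (E : graph) : rel (edge E) := fun e f => rng e == src f.

Definition is_cycle (E : graph) (c : seq (edge E)) : Prop :=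
  [/\ c != [::], cycle (@succ_edge E) c & uniq (map (@src E) c)].

Definition has_exit (E : graph) (c : seq (edge E)) : Prop :=
  exists (f : edge E) (i : nat),
    (i < size c)%N /\ src f = src (nth f c i) /\ f <> nth f c i.

Definition condition_L (E : graph) : Prop :=
  forall c : seq (edge E), is_cycle c -> has_exit c.

(* finite paths E^*: a vertex (v, [::]) or a nonempty edge path (v, e::p)  *)
(* with s(e) = v and r(e_i) = s(e_{i+1})                                    *)
Definition is_fpath (E : graph) (v : 'I_(nV E)) (p : seq (edge E)) : bool :=
  if p is e :: p' then (src e == v) && path (@succ_edge E) e p' else true.

Section Leavitt.
Variables (R : comNzRingType) (E : graph).

(* pv v = v, pe e = e, pg e = e^* *)
Record LFamily (C : algType R) := LFam {
  pv : 'I_(nV E) -> C;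
  pe : edge E -> C;
  pg : edge E -> C }.

Definition is_Leavitt_family (C : algType R) (X : LFamily C) : Prop :=
  [/\ (forall v w, pv X v * pv X w = if v == w then pv X v else 0),
      (forall e f, pg X e * pe X f = if e == f then pv X (rng e) else 0),
      (forall e, pv X (src e) * pe X e = pe X e /\ pe X e * pv X (rng e) = pe X e),
      (forall e, pg X e * pv X (src e) = pg X e /\ pv X (rng e) * pg X e = pg X e) &
      (forall v, (exists e : edge E, src e == v) ->
          pv X v = \sum_(e : edge E | src e == v) pe X e * pg X e)].

(* An R-algebra homomorphism (not required to preserve the unit).           *)
Definition alg_hom (A C : algType R) (phi : A -> C) : Prop :=
  [/\ (forall x y, phi (x + y) = phi x + phi y),
      (forall (a : R) x, phi (a *: x) = a *: phi x) &
      (forall x y, phi (x * y) = phi x * phi y)].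

Definition is_Leavitt_path_algebra (A : algType R) (X : LFamily A) : Prop :=
  is_Leavitt_family X /\
  forall (C : algType R) (Y : LFamily C), is_Leavitt_family Y ->
    exists! phi : A -> C,
      [/\ alg_hom phi,
          (forall v, phi (pv X v) = pv Y v),
          (forall e, phi (pe X e) = pe Y e) &
          (forall e, phi (pg X e) = pg Y e)].

Definition is_LPA_involution (conjR : R -> R) (A : algType R) (X : LFamily A)
    (st : A -> A) : Prop :=
  [/\ (forall x y, st (x + y) = st x + st y),
      (forall (a : R) x, st (a *: x) = conjR a *: st x),
      (forall x y, st (x * y) = st y * st x),
      (forall x, st (st x) = x) &
      (forall v, st (pv X v) = pv X v) /\
      (forall e, st (pe X e) = pg X e)].

Definition diag_gen (A : algType R) (X : LFamily A) (v : 'I_(nV E))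
    (p : seq (edge E)) : A :=
  if p is [::] then pv X v
  else (\prod_(e <- p) pe X e) * (\prod_(e <- rev p) pg X e).

Definition in_diagonal (A : algType R) (X : LFamily A) (x : A) : Prop :=
  exists s : seq (R * ('I_(nV E) * seq (edge E))),
    all (fun t => is_fpath t.2.1 t.2.2) s /\
    x = \sum_(t <- s) t.1 *: diag_gen X t.2.1 t.2.2.

Definition is_projection (A : algType R) (st : A -> A) (p : A) : Prop :=
  p * p = p /\ st p = p.

End Leavitt.

Definition star_iso (R : comNzRingType) (A B : algType R) (stA : A -> A)
    (stB : B -> B) (psi : A -> B) : Prop :=
  [/\ bijective psi,
      (forall x y, psi (x + y) = psi x + psi y),
      (forall (a : R) x, psi (a *: x) = a *: psi x),
      (forall x y, psi (x * y) = psi x * psi y) &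
      (forall x, psi (stA x) = stB (psi x))].

(* Main.v *)
(** Identify the two algebras along the *-isomorphism, so that one algebra [L]
carries a Leavitt family of [E] and one of [F].

Every projection of [L] lies in the diagonal of [F], and by Condition (L) the
diagonal of [E] is its own commutant; hence the two diagonals coincide, [D] say.
Grade [L] by the path length in [E]. If [f_k] is a homogeneous component of an
edge [f] of [F], then [f^* f_k] commutes with [D], hence lies in [D]. It follows
that [f a a^*] is homogeneous for every long path [a] of [F], i.e. the
[E]-degree is an integer weight on the edges of a higher block graph of [F].
Closed paths have positive weight: otherwise [u = z h^*] ([z] a closed extension
of [h]) would satisfy [u u^* < u^* u] with [deg u <= 0], which is refuted by
counting the long paths of [E] below both projections. After rescaling, a potential
makes all the edge weights positive.

Consider the module over [R[t]] (up to [t]-torsion) of classes [a a^*] subject to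
[[u u^*] = t^(deg u) [u^* u]] for homogeneous [u]. It is presented both by
[I - t A] for [E] and by [I - B(t)] for the weighted block graph of [F]. Hence
each determinant divides the other up to a power of [t] (the easy half of the
invariance of Fitting ideals), and as both have constant term [1] they are equal.
At [t = 1] this gives [det (I - A_E) = det (I - A_F)]. *)

From Stdlib Require RIneq Psatz.
Require Import Defs.
From HB Require Import structures.
From mathcomp Require Import all_boot all_order all_algebra zify.
From mathcomp Require Import boolp.
Set Implicit Arguments.
Unset Strict Implicit.
Unset Printing Implicit Defensive.

Import Order.TTheory GRing.Theory Num.Theory.
Local Open Scope ring_scope.

(** * Subrings of the complex numbers *)

(** The obstacle is that the isomorphism need not respect gradings: an edge [f] of [F] may spread
    over several [E]-degrees. The common diagonal controls this spread. If [d] is diagonal, so is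
    [f d f^*], and both have degree 0; hence [f_k d = f d f^* f_k], which is why [f^* f_k] commutes
    with [D]. The level at which these elements appear in [D] says how many letters after [f]
    determine its degree, and this number gives the block length. The resulting weights can be zero
    or negative on single letters, and then the weighted determinant need not have constant term 1.
    A coboundary corrects them without changing closed paths, but an integral one with increments at
    least 1 is obtained only after multiplying all degrees by a constant [K]. Accordingly an edge of
    [E] gets weight [K] rather than 1. Degrees are integers while exponents are natural numbers.
    Congruences therefore carry powers of ['X] on both sides and are read modulo the ['X]-saturation
    of the relations; the constant term 1 allows these powers to be cancelled in the end. *)

Lemma cpx_mul_eq0 z w : cpx_mul z w = cpx0 -> z = cpx0 \/ w = cpx0.
Proof.
case: z w => [a b] [c d] [re im].
have [ha|ha] := RIneq.Req_dec a Rdefinitions.R0.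
  subst a; have [->|hb] := RIneq.Req_dec b Rdefinitions.R0; first by left.
  right; congr Cpx; apply: (RIneq.Rmult_eq_reg_l b) hb; Psatz.lra.
(* [s] is the squared norm of [z]: multiplying by the conjugate of [z] isolates each coordinate of
   [w]. *)
right; pose s := Rdefinitions.Rplus (Rdefinitions.Rmult a a) (Rdefinitions.Rmult b b).
have hs : s <> Rdefinitions.R0 by rewrite /s; Psatz.nra.
rewrite /cpx0; congr Cpx; apply: (RIneq.Rmult_eq_reg_l s) hs; rewrite /s.
  have := f_equal (Rdefinitions.Rmult a) re; have := f_equal (Rdefinitions.Rmult b) im.
  Psatz.lra.
have := f_equal (Rdefinitions.Rmult a) im; have := f_equal (Rdefinitions.Rmult b) re.
Psatz.lra.
Qed.

Section Subring.
Variables (R : comNzRingType) (iota : R -> cpx) (conjR : R -> R).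
Hypothesis hR : conj_closed_subring_of_C iota conjR.

Lemma iota0 : iota 0 = cpx0.
Proof.
have [_ _ hD _ _] := hR; have := hD 0 0; rewrite addr0.
by case: (iota 0) => a b [ha hb]; congr Cpx; Psatz.lra.
Qed.

(** Absence of zero divisors is used to make the coefficients of idempotents 0 or 1 and the algebra
    torsion-free over [R]. *)
Lemma subring_domain (a b : R) : a * b = 0 -> a = 0 \/ b = 0.
Proof.
have [inj _ _ hM _] := hR => ab; have := hM a b; rewrite ab iota0 => /esym/cpx_mul_eq0.
by rewrite -iota0 => -[/inj|/inj]; [left | right].
Qed.

Lemma iota_nat n : iota n%:R = Cpx (Raxioms.INR n) Rdefinitions.R0.
Proof.
have [_ h1 hD _ _] := hR; elim: n => [|n IHn]; first exact: iota0.
rewrite -natr1 hD IHn h1 RIneq.S_INR; congr Cpx => /=; Psatz.lra.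
Qed.

Lemma subring_char0 n : (n%:R : R) = 0 -> n = 0%N.
Proof.
move=> n0; have := iota_nat n; rewrite n0 iota0 => -[] /esym h.
exact: (RIneq.INR_eq n 0%N).
Qed.

(** Allows integer determinants to be compared after mapping them into [R]. *)
Lemma subring_intr_inj : injective (fun z : int => z%:~R : R).
Proof.
move=> y z /eqP; rewrite -subr_eq0 -rmorphB /= => /eqP h.
apply/eqP; rewrite -subr_eq0; case: (y - z) h => n; first by move=> /subring_char0 ->.
by rewrite NegzE mulrNz => /eqP; rewrite oppr_eq0 => /eqP /subring_char0.
Qed.
End Subring.

(** * Algebras of linear operators *)

(* The point [t0] only serves to make the algebra nontrivial. *)
Record op (R : comNzRingType) (T : Type) (t0 : T) (M : algType R) := Op {
  opf :> (T -> M) -> (T -> M);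
  op_lin : forall a f g, opf (fun t => a *: f t + g t) =
                         (fun t => a *: opf f t + opf g t) }.

Section OpAlgebra.
Variables (R : comNzRingType) (T : Type) (t0 : T) (M : algType R).
Implicit Types u v w : op t0 M.

Lemma opP u v : (forall f t, u f t = v f t) -> u = v.
Proof.
case: u v => [u ul] [v vl] /= uv.
have e : u = v by apply: functional_extensionality_dep => f; apply: functional_extensionality_dep => t.
by case: _ / e vl => vl; congr (Op _ _); exact: Prop_irrelevance.
Qed.

HB.instance Definition _ := gen_eqMixin (op t0 M).
HB.instance Definition _ := gen_choiceMixin (op t0 M).

Lemma op_add_lin u v a f g :
  (fun t => u (fun t => a *: f t + g t) t + v (fun t => a *: f t + g t) t) =
  (fun t => a *: (u f t + v f t) + (u g t + v g t)).
Proof. by rewrite !op_lin; apply: funext => t; rewrite scalerDr addrACA. Qed.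

Lemma op_scale_lin c u a f g :
  (fun t => c *: u (fun t => a *: f t + g t) t) =
  (fun t => a *: (c *: u f t) + c *: u g t).
Proof. by rewrite !op_lin; apply: funext => t; rewrite scalerDr !scalerA mulrC. Qed.

Lemma op_mul_lin u v a f g :
  u (v (fun t => a *: f t + g t)) = (fun t => a *: u (v f) t + u (v g) t).
Proof. by rewrite !op_lin. Qed.

Lemma op_zero_lin (a : R) (f g : T -> M) :
  (fun=> 0) = (fun t : T => a *: (0 : M) + 0).
Proof. by apply: funext => t; rewrite scaler0 addr0. Qed.

Lemma op_id_lin (a : R) (f g : T -> M) :
  (fun t => a *: f t + g t) = (fun t => a *: f t + g t).
Proof. by []. Qed.

Definition op_add u v : op t0 M := Op t0 (op_add_lin u v).
Definition op_scale c u : op t0 M := Op t0 (op_scale_lin c u).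
Definition op_mul u v : op t0 M := Op t0 (op_mul_lin u v).
Definition op_zero : op t0 M := Op t0 op_zero_lin.
Definition op_id : op t0 M := Op t0 op_id_lin.

Lemma op_addA : associative op_add.
Proof. by move=> u v w; apply: opP => f t /=; rewrite addrA. Qed.
Lemma op_addC : commutative op_add.
Proof. by move=> u v; apply: opP => f t /=; rewrite addrC. Qed.
Lemma op_add0 : left_id op_zero op_add.
Proof. by move=> u; apply: opP => f t /=; rewrite add0r. Qed.
Lemma op_addN : left_inverse op_zero (op_scale (-1)) op_add.
Proof. by move=> u; apply: opP => f t /=; rewrite scaleN1r addNr. Qed.

HB.instance Definition _ :=
  GRing.isZmodule.Build (op t0 M) op_addA op_addC op_add0 op_addN.

Lemma op_mulA : associative op_mul. Proof. by move=> u v w; apply: opP. Qed.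
Lemma op_mul1 : left_id op_id op_mul. Proof. by move=> u; apply: opP. Qed.
Lemma op_1mul : right_id op_id op_mul. Proof. by move=> u; apply: opP. Qed.
Lemma op_mulDl : left_distributive op_mul op_add.
Proof. by move=> u v w; apply: opP. Qed.
Lemma op_D u (f g : T -> M) t : u (fun t => f t + g t) t = u f t + u g t.
Proof.
have := op_lin u 1 f g => /(congr1 (@^~ t)) /=; rewrite scale1r => <-.
by congr (u _ t); apply: funext => s; rewrite scale1r.
Qed.
Lemma op_mulDr : right_distributive op_mul op_add.
Proof. by move=> u v w; apply: opP => f t /=; rewrite op_D. Qed.
Lemma op_neq10 : op_id != op_zero.
Proof.
apply/eqP => /(congr1 (fun u : op t0 M => u (fun=> 1) t0)) /= /eqP.
by rewrite oner_eq0.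
Qed.

HB.instance Definition _ := GRing.Zmodule_isNzRing.Build (op t0 M)
  op_mulA op_mul1 op_1mul op_mulDl op_mulDr op_neq10.

Lemma op_scaleA a b u : op_scale a (op_scale b u) = op_scale (a * b) u.
Proof. by apply: opP => f t /=; rewrite scalerA. Qed.
Lemma op_scale1 : left_id 1 op_scale.
Proof. by move=> u; apply: opP => f t /=; rewrite scale1r. Qed.
Lemma op_scaleDr : right_distributive op_scale +%R.
Proof. by move=> a u v; apply: opP => f t /=; rewrite scalerDr. Qed.
Lemma op_scaleDl u : {morph op_scale^~ u : a b / a + b}.
Proof. by move=> a b; apply: opP => f t /=; rewrite scalerDl. Qed.

HB.instance Definition _ := GRing.Zmodule_isLmodule.Build R (op t0 M)
  op_scaleA op_scale1 op_scaleDr op_scaleDl.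

Lemma op_scaleAl (a : R) u v : a *: (u * v) = (a *: u) * v.
Proof. by apply: opP. Qed.
HB.instance Definition _ := GRing.Lmodule_isLalgebra.Build R (op t0 M) op_scaleAl.

Lemma op_Z u (a : R) (f : T -> M) t : u (fun t => a *: f t) t = a *: u f t.
Proof.
have := op_lin u a f (fun=> 0) => /(congr1 (@^~ t)) /=.
have -> : (fun t => a *: f t + 0) = (fun t => a *: f t).
  by apply: funext => s; rewrite addr0.
move=> ->; suff -> : u (fun=> 0) t = 0 by rewrite addr0.
have := op_D u (fun=> 0) (fun=> 0) t.
rewrite (_ : (fun _ : T => 0 + 0) = (fun=> 0 : M)); last by apply: funext => s; rewrite addr0.
by move=> /eqP; rewrite -subr_eq subrr eq_sym => /eqP.
Qed.
Lemma op_scaleAr (a : R) u v : a *: (u * v) = u * (a *: v).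
Proof. by apply: opP => f t /=; rewrite op_Z. Qed.
HB.instance Definition _ := GRing.Lalgebra_isAlgebra.Build R (op t0 M) op_scaleAr.

Lemma op_addE u v f t : (u + v) f t = u f t + v f t. Proof. by []. Qed.
Lemma op_mulE u v f t : (u * v) f t = u (v f) t. Proof. by []. Qed.
Lemma op_scaleE a u f t : (a *: u) f t = a *: u f t. Proof. by []. Qed.
Lemma op_sumE I (r : seq I) (P : pred I) (F : I -> op t0 M) f t :
  (\sum_(i <- r | P i) F i) f t = \sum_(i <- r | P i) F i f t.
Proof. by elim/big_rec2: _ => // i y1 y2 _ <-. Qed.
End OpAlgebra.

(** * Leavitt path algebras are spanned by the monomials *)

Section Generated.
Variables (R : comNzRingType) (E : graph) (L : algType R) (X : LFamily E L).

(** There is no constructor for the unit: homomorphisms in the universal property need not preserve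
    it, so that [1] is the sum of the vertices has to be proved ([LPA_one]). *)
Inductive gen : L -> Prop :=
| gen_v v : gen (pv X v)
| gen_e e : gen (pe X e)
| gen_g e : gen (pg X e)
| gen_0 : gen 0
| gen_D a b : gen a -> gen b -> gen (a + b)
| gen_Z c a : gen a -> gen (c *: a)
| gen_M a b : gen a -> gen b -> gen (a * b).

Lemma gen_sum I (r : seq I) (P : pred I) (F : I -> L) :
  (forall i, P i -> gen (F i)) -> gen (\sum_(i <- r | P i) F i).
Proof. by move=> h; elim/big_rec: _ => [|i x Pi]; [exact: gen_0 | apply: gen_D; exact: h]. Qed.

Definition genp : {pred L} := fun a => `[<gen a>].
Lemma genP a : reflect (gen a) (a \in genp). Proof. exact: asboolP. Qed.

Lemma genp_submod : submod_closed genp.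
Proof.
split=> [|c a b]; first exact/genP/gen_0.
by move=> /genP ga /genP gb; apply/genP/gen_D => //; apply: gen_Z.
Qed.
HB.instance Definition _ := GRing.isSubmodClosed.Build R L genp genp_submod.

Record gen_alg := GenAlg { gen_val : L; gen_valP : gen_val \in genp }.
HB.instance Definition _ := [isSub for gen_val].
HB.instance Definition _ := [Choice of gen_alg by <:].
HB.instance Definition _ := [SubChoice_isSubZmodule of gen_alg by <:].
HB.instance Definition _ := [SubZmodule_isSubLmodule of gen_alg by <:].

Hypothesis hX : is_Leavitt_family X.

(* The unit of the subalgebra generated by the family; a priori not that of [L]. *)
Definition unit_elt : L := \sum_v pv X v.

Lemma unit_gen a : gen a -> unit_elt * a = a /\ a * unit_elt = a.
Proof.
have [hv he hs hg _] := hX.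
have zv v : unit_elt * pv X v = pv X v.
  rewrite mulr_suml (bigD1 v) //= hv eqxx big1 ?addr0 // => w wv.
  by rewrite hv (negPf wv).
have vz v : pv X v * unit_elt = pv X v.
  rewrite mulr_sumr (bigD1 v) //= hv eqxx big1 ?addr0 // => w wv.
  by rewrite hv eq_sym (negPf wv).
elim=> {a} [v|e|e||a b _ [za az] _ [zb bz]|c a _ [za az]|a b _ [za az] _ [zb bz]].
- by split.
- by have [<- <-] := hs e; split; rewrite ?mulrA ?zv // -!mulrA vz.
- by have [<- <-] := hg e; split; rewrite ?mulrA ?zv // -!mulrA vz.
- by rewrite mulr0 mul0r.
- by rewrite mulrDr za zb mulrDl az bz.
- by rewrite -scalerAr za -scalerAl az.
- by rewrite mulrA za -mulrA bz.
Qed.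

Hypothesis unit_neq0 : unit_elt != 0.

Lemma gen_unit : unit_elt \in genp.
Proof. by apply/genP/gen_sum => v _; exact: gen_v. Qed.
Lemma gen_mulP (a b : gen_alg) : gen_val a * gen_val b \in genp.
Proof. by apply/genP/gen_M; apply/genP/gen_valP. Qed.

Definition gen_one := GenAlg gen_unit.
Definition gen_mul (a b : gen_alg) := GenAlg (gen_mulP a b).

Lemma gen_mulA : associative gen_mul.
Proof. by move=> a b c; apply: val_inj; rewrite /= mulrA. Qed.
Lemma gen_mul1l : left_id gen_one gen_mul.
Proof. by move=> a; apply: val_inj => /=; have /genP/unit_gen[] := gen_valP a. Qed.
Lemma gen_mul1r : right_id gen_one gen_mul.
Proof. by move=> a; apply: val_inj => /=; have /genP/unit_gen[] := gen_valP a. Qed.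
Lemma gen_mulDl : left_distributive gen_mul +%R.
Proof. by move=> a b c; apply: val_inj; rewrite /= mulrDl. Qed.
Lemma gen_mulDr : right_distributive gen_mul +%R.
Proof. by move=> a b c; apply: val_inj; rewrite /= mulrDr. Qed.
Lemma gen_one_neq0 : gen_one != 0.
Proof. by apply: contra unit_neq0 => /eqP/(congr1 val)/= ->. Qed.

HB.instance Definition _ := GRing.Zmodule_isNzRing.Build gen_alg
  gen_mulA gen_mul1l gen_mul1r gen_mulDl gen_mulDr gen_one_neq0.

Lemma gen_scaleAl (c : R) (a b : gen_alg) : c *: (a * b) = (c *: a) * b.
Proof. by apply: val_inj; rewrite /= scalerAl. Qed.
HB.instance Definition _ := GRing.Lmodule_isLalgebra.Build R gen_alg gen_scaleAl.
Lemma gen_scaleAr (c : R) (a b : gen_alg) : c *: (a * b) = a * (c *: b).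
Proof. by apply: val_inj; rewrite /= scalerAr. Qed.
HB.instance Definition _ := GRing.Lalgebra_isAlgebra.Build R gen_alg gen_scaleAr.

Lemma gen_family : exists Y : LFamily E gen_alg, is_Leavitt_family Y /\
  [/\ forall v, val (pv Y v) = pv X v, forall e, val (pe Y e) = pe X e &
      forall e, val (pg Y e) = pg X e].
Proof.
have hv v : pv X v \in genp by apply/genP/gen_v.
have he e : pe X e \in genp by apply/genP/gen_e.
have hg e : pg X e \in genp by apply/genP/gen_g.
have [h1 h2 h3 h4 h5] := hX.
exists (LFam (fun v => GenAlg (hv v)) (fun e => GenAlg (he e)) (fun e => GenAlg (hg e))).
split; last by split.
split=> /=.
- by move=> v w; apply: val_inj; rewrite /= h1; case: eqP.
- by move=> e f; apply: val_inj; rewrite /= h2; case: eqP.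
- by move=> e; have [a b] := h3 e; split; apply: val_inj.
- by move=> e; have [a b] := h4 e; split; apply: val_inj.
- move=> v /h5 eqv; apply: val_inj; rewrite /= eqv.
  by rewrite (big_morph val (id1 := 0) (op1 := +%R)).
Qed.

End Generated.

Section Universal.
Variables (R : comNzRingType) (E : graph) (L : algType R) (X : LFamily E L).
Hypothesis hX : is_Leavitt_path_algebra X.

Lemma LPA_hom_id (phi : L -> L) : alg_hom phi ->
  (forall v, phi (pv X v) = pv X v) -> (forall e, phi (pe X e) = pe X e) ->
  (forall e, phi (pg X e) = pg X e) -> forall a, phi a = a.
Proof.
move=> hphi pv_ pe_ pg_ a; have [hf hu] := hX.
have [psi [_ uniq_psi]] := hu L X hf.
by rewrite -(uniq_psi phi) // (uniq_psi id).
Qed.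

(** If the sum vanished, so would all generators, and the zero map would fix them; uniqueness would
    make it the identity, although [1] is nonzero. *)
Lemma LPA_unit_neq0 : unit_elt X != 0.
Proof.
apply/eqP => z0; have [hf _] := hX.
have g0 a : gen X a -> a = 0.
  by move=> /(unit_gen hf) [<- _]; rewrite z0 mul0r.
suff: (0 : L) = 1 by move/eqP; rewrite eq_sym oner_eq0.
apply: (@LPA_hom_id (fun=> 0)).
- by split=> *; rewrite ?addr0 ?scaler0 ?mulr0.
- by move=> v; rewrite (g0 _ (gen_v X v)).
- by move=> v; rewrite (g0 _ (gen_e X v)).
- by move=> v; rewrite (g0 _ (gen_g X v)).
Qed.

(** The universal map into the generated subalgebra, followed by the inclusion, fixes the generators
    and is therefore the identity. *)
Lemma LPA_gen a : gen X a.
Proof.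
have [hf hu] := hX.
have [Y [hY [Yv Ye Yg]]] := gen_family hf LPA_unit_neq0.
have [phi [[[pD pZ pM] phv phe phg] _]] := hu _ Y hY.
suff <- : val (phi a) = a by exact/genP/gen_valP.
apply: (@LPA_hom_id (fun a => val (phi a))).
- by split=> *; rewrite ?pD ?pZ ?pM.
- by move=> v; rewrite phv Yv.
- by move=> v; rewrite phe Ye.
- by move=> v; rewrite phg Yg.
Qed.

Lemma LPA_one : 1 = \sum_v pv X v.
Proof. by have [hf _] := hX; have [<- _] := unit_gen hf (LPA_gen 1); rewrite mulr1. Qed.
End Universal.

(** * Words of a fixed length and their monomials *)

Section Words.
Variable T : finType.

(** All words are listed, not only paths: monomials of non-paths vanish, so sums over words need no
    side condition. *)
Fixpoint words n : seq (seq T) :=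
  if n is n'.+1 then [seq rcons p e | p <- words n', e <- enum T] else [:: [::]].

Lemma mem_words n p : (p \in words n) = (size p == n).
Proof.
elim: n p => [|n IHn] p; first by rewrite inE; case: p.
apply/allpairsP/idP => [[[q e] /= [qn _ ->]]|].
  by rewrite size_rcons eqSS -IHn.
case/lastP: p => // q e; rewrite size_rcons eqSS -IHn => qn.
by exists (q, e); rewrite /= mem_enum.
Qed.

Lemma uniq_words n : uniq (words n).
Proof.
elim: n => //= n IHn; apply: allpairs_uniq => //; first exact: enum_uniq.
by move=> [p e] [q f] _ _ /= /eqP; rewrite eqseq_rcons => /andP[/eqP -> /eqP ->].
Qed.

Lemma sum_wordsS (V : zmodType) n (F : seq T -> V) :
  \sum_(p <- words n.+1) F p = \sum_(p <- words n) \sum_e F (rcons p e).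
Proof. by rewrite /= big_allpairs_dep; apply: eq_bigr => p _; rewrite big_enum. Qed.

Lemma sum_wordsD (V : zmodType) n k (F : seq T -> V) :
  \sum_(p <- words (n + k)) F p = \sum_(p <- words n) \sum_(q <- words k) F (p ++ q).
Proof.
elim: k F => [|k IHk] F.
  by rewrite addn0; apply: eq_bigr => p _; rewrite big_seq1 cats0.
rewrite addnS sum_wordsS IHk; apply: eq_bigr => p _.
by rewrite sum_wordsS; apply: eq_bigr => q _; apply: eq_bigr => e _; rewrite rcons_cat.
Qed.

Lemma sum_words1 (V : zmodType) n p (F : seq T -> V) : size p = n ->
  (forall q, size q = n -> q != p -> F q = 0) ->
  \sum_(q <- words n) F q = F p.
Proof.
move=> sp F0; rewrite (bigD1_seq p) ?mem_words ?sp ?uniq_words //= big_seq_cond.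
by rewrite big1 ?addr0 // => q /andP[]; rewrite mem_words => /eqP sq; exact: F0.
Qed.

Lemma eq_sum_words (V : zmodType) n (F G : seq T -> V) :
  (forall q, size q = n -> F q = G q) ->
  \sum_(q <- words n) F q = \sum_(q <- words n) G q.
Proof. by move=> FG; rewrite !big_seq; apply: eq_bigr => q; rewrite mem_words => /eqP/FG. Qed.
End Words.

Definition pth (E : graph) (p : seq (edge E)) : bool := sorted (@succ_edge E) p.

Lemma sorted_rcons2 (T : eqType) (r : rel T) p x y :
  sorted r (rcons (rcons p x) y) = sorted r (rcons p x) && r x y.
Proof. by case: p => [|z p] /=; rewrite ?andbT // !rcons_path last_rcons. Qed.

Section Monomials.
Variables (R : comNzRingType) (E : graph) (L : algType R) (X : LFamily E L).
Hypothesis hX : is_Leavitt_family X.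
Implicit Types p q : seq (edge E).

(* [mm p] and [gg p] are the paper's [p] and [p^*]; they vanish unless [p] is a path.
   [vtx p] is then the range of [p], except that the empty word gives [1]. *)
Definition mm p : L := \prod_(e <- p) pe X e.
Definition gg p : L := \prod_(e <- rev p) pg X e.
Definition vtx p : L := gg p * mm p.

Lemma mm_nil : mm [::] = 1. Proof. exact: big_nil. Qed.
Lemma gg_nil : gg [::] = 1. Proof. exact: big_nil. Qed.
Lemma mm_cat p q : mm (p ++ q) = mm p * mm q. Proof. exact: big_cat. Qed.
Lemma gg_cat p q : gg (p ++ q) = gg q * gg p.
Proof. by rewrite /gg rev_cat big_cat. Qed.
Lemma mm1 e : mm [:: e] = pe X e. Proof. exact: big_seq1. Qed.
Lemma gg1 e : gg [:: e] = pg X e. Proof. exact: big_seq1. Qed.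
Lemma mm_cons e p : mm (e :: p) = pe X e * mm p. Proof. exact: big_cons. Qed.
Lemma gg_cons e p : gg (e :: p) = gg p * pg X e.
Proof. by rewrite -cat1s gg_cat gg1. Qed.
Lemma mm_rcons p e : mm (rcons p e) = mm p * pe X e.
Proof. by rewrite -cats1 mm_cat mm1. Qed.
Lemma gg_rcons p e : gg (rcons p e) = pg X e * gg p.
Proof. by rewrite -cats1 gg_cat gg1. Qed.
Lemma vtx_nil : vtx [::] = 1. Proof. by rewrite /vtx mm_nil gg_nil mulr1. Qed.
Lemma vtx_rconsE p e : vtx (rcons p e) = pg X e * vtx p * pe X e.
Proof. by rewrite /vtx gg_rcons mm_rcons !mulrA. Qed.
Lemma vtx_cat p q : vtx (p ++ q) = gg q * vtx p * mm q.
Proof. by rewrite /vtx gg_cat mm_cat !mulrA. Qed.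

Lemma pv_pe v e : pv X v * pe X e = if v == src e then pe X e else 0.
Proof.
have [h1 _ /(_ e)[h3 _] _ _] := hX.
by rewrite -{1}h3 mulrA h1; case: eqP => [->|_]; rewrite ?h3 ?mul0r.
Qed.
Lemma pg_pv v e : pg X e * pv X v = if v == src e then pg X e else 0.
Proof.
have [h1 _ _ /(_ e)[h3 _] _] := hX.
by rewrite -{1}h3 -mulrA h1; case: eqP => [<-|nv]; case: eqP => [//|nv']; rewrite ?mulr0 ?h3 //; congruence.
Qed.
Lemma pe_pv v e : pe X e * pv X v = if v == rng e then pe X e else 0.
Proof.
have [h1 _ /(_ e)[_ h3] _ _] := hX.
by rewrite -{1}h3 -mulrA h1; case: eqP => [<-|nv]; case: eqP => [//|nv']; rewrite ?mulr0 ?h3 //; congruence.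
Qed.
Lemma pv_pg v e : pv X v * pg X e = if v == rng e then pg X e else 0.
Proof.
have [h1 _ _ /(_ e)[_ h3] _] := hX.
by rewrite -{1}h3 mulrA h1; case: eqP => [->|_]; rewrite ?h3 ?mul0r.
Qed.

Lemma vtx_rcons p e : vtx (rcons p e) = if pth (rcons p e) then pv X (rng e) else 0.
Proof.
have [_ h2 _ _ _] := hX.
elim/last_ind: p e => [|p f IHp] e.
  by rewrite vtx_rconsE vtx_nil mulr1 h2 eqxx.
rewrite vtx_rconsE IHp /pth sorted_rcons2 -/(pth _); case: (pth _) => /=; last first.
  by rewrite mulr0 mul0r.
by rewrite -mulrA pv_pe /succ_edge; case: eqP; rewrite ?mulr0 // h2 eqxx.
Qed.

Lemma vtx_pe p e : vtx p * pe X e = if pth (rcons p e) then pe X e else 0.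
Proof.
case/lastP: p => [|p f]; first by rewrite vtx_nil mul1r.
rewrite vtx_rcons /pth sorted_rcons2 -/(pth _); case: (pth _); rewrite ?mul0r //.
by rewrite pv_pe.
Qed.

Lemma not_pth_rcons p e : ~~ pth p -> ~~ pth (rcons p e).
Proof. by case/lastP: p => // p f; rewrite /pth sorted_rcons2 => /negPf ->. Qed.

Lemma mm_not_pth p : ~~ pth p -> mm p = 0.
Proof.
elim/last_ind: p => // p e IHp; rewrite mm_rcons.
case/lastP: p IHp => // p f IHp; rewrite {1}/pth sorted_rcons2 negb_and -/(pth _).
case/orP => [/IHp -> | nfe]; first by rewrite mul0r.
have [_ _ /(_ f)[_ h3] _ _] := hX.
rewrite mm_rcons -mulrA -h3 -!mulrA pv_pe; move: nfe; rewrite /succ_edge => /negPf ->.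
by rewrite !mulr0.
Qed.

Lemma gg_not_pth p : ~~ pth p -> gg p = 0.
Proof.
elim/last_ind: p => // p e IHp; rewrite gg_rcons.
case/lastP: p IHp => // p f IHp; rewrite {1}/pth sorted_rcons2 negb_and -/(pth _).
case/orP => [/IHp -> | nfe]; first by rewrite mulr0.
have [_ _ _ /(_ f)[_ h3] _] := hX.
rewrite gg_rcons -h3 !mulrA pg_pv; move: nfe; rewrite /succ_edge => /negPf ->.
by rewrite !mul0r.
Qed.

Lemma vtx_not_pth p : ~~ pth p -> vtx p = 0.
Proof. by move=> np; rewrite /vtx mm_not_pth // mulr0. Qed.

Lemma mm_vtx p : mm p * vtx p = mm p.
Proof.
case/lastP: p => [|p e]; first by rewrite vtx_nil mulr1.
rewrite vtx_rcons; case: (boolP (pth _)) => [_|/mm_not_pth ->]; last by rewrite mul0r.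
by rewrite mm_rcons -mulrA pe_pv eqxx.
Qed.

Lemma vtx_gg p : vtx p * gg p = gg p.
Proof.
case/lastP: p => [|p e]; first by rewrite vtx_nil mul1r.
rewrite vtx_rcons; case: (boolP (pth _)) => [_|/gg_not_pth ->]; last by rewrite mulr0.
by rewrite gg_rcons mulrA pv_pg eqxx.
Qed.

Lemma vtx_vtx p : vtx p * vtx p = vtx p.
Proof. by rewrite {2}/vtx mulrA vtx_gg. Qed.

Lemma gg_mm p q : size p = size q -> gg p * mm q = if p == q then vtx p else 0.
Proof.
elim/last_ind: p q => [|p e IHp] q; case/lastP: q => [|q f]; rewrite ?size_rcons //.
move=> [/IHp gm]; rewrite gg_rcons mm_rcons !mulrA -(mulrA _ (gg p)) gm eqseq_rcons.
case: eqP => [->|_] /=; last by rewrite mulr0 mul0r.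
case: eqP => [->|ef]; first by rewrite vtx_rconsE.
rewrite -mulrA vtx_pe; case: ifP; rewrite ?mulr0 // => _.
by have [_ -> _ _ _] := hX; case: eqP ef.
Qed.

Lemma pth_cat1 p q : pth (p ++ q) -> pth p.
Proof. by case: p => //= e p; rewrite cat_path => /andP[]. Qed.
Lemma pth_cat2 p q : pth (p ++ q) -> pth q.
Proof. by elim: p => //= e p IHp /path_sorted. Qed.

Hypothesis nosink : forall v : 'I_(nV E), exists e : edge E, src e = v.
Hypothesis one_sum : 1 = \sum_v pv X v.

Lemma pv_sum v : pv X v = \sum_(e | src e == v) pe X e * pg X e.
Proof. by have [_ _ _ _ ->] := hX => //; have [e <-] := nosink v; exists e. Qed.

Lemma one_edges : 1 = \sum_e pe X e * pg X e.
Proof.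
rewrite one_sum (partition_big (@src E) xpredT) //=.
by apply: eq_bigr => v _; exact: pv_sum.
Qed.

Lemma one_words n : 1 = \sum_(p <- words (edge E) n) mm p * gg p.
Proof.
elim: n => [|n IHn]; first by rewrite big_seq1 mm_nil gg_nil mulr1.
rewrite sum_wordsS {1}IHn; apply: eq_bigr => p _.
rewrite -{1}(mulr1 (mm p)) one_edges mulr_sumr mulr_suml; apply: eq_bigr => e _.
by rewrite mm_rcons gg_rcons !mulrA.
Qed.

(** The Cuntz-Krieger relation iterated [k] times; it brings elements of different levels to a
    common one. *)
Lemma mg_words p k : mm p * gg p = \sum_(q <- words (edge E) k) mm (p ++ q) * gg (p ++ q).
Proof.
rewrite -{1}(mulr1 (mm p)) (one_words k) mulr_sumr mulr_suml; apply: eq_bigr => q _.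
by rewrite mm_cat gg_cat !mulrA.
Qed.

Lemma mg_words2 p p' k : mm p * gg p' = \sum_(q <- words (edge E) k) mm (p ++ q) * gg (p' ++ q).
Proof.
rewrite -{1}(mulr1 (mm p)) (one_words k) mulr_sumr mulr_suml; apply: eq_bigr => q _.
by rewrite mm_cat gg_cat !mulrA.
Qed.

Definition lin_comb (s : seq (R * (seq (edge E) * seq (edge E)))) : L :=
  \sum_(t <- s) t.1 *: (mm t.2.1 * gg t.2.2).
Definition spanned a := exists s, a = lin_comb s.

Lemma spanned1 p q : spanned (mm p * gg q).
Proof. by exists [:: (1, (p, q))]; rewrite /lin_comb big_seq1 scale1r. Qed.
Lemma spanned0 : spanned 0. Proof. by exists [::]; rewrite /lin_comb big_nil. Qed.
Lemma spannedD a b : spanned a -> spanned b -> spanned (a + b).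
Proof. by move=> [s ->] [t ->]; exists (s ++ t); rewrite /lin_comb big_cat. Qed.
Lemma spannedZ c a : spanned a -> spanned (c *: a).
Proof.
move=> [s ->]; exists [seq (c * t.1, t.2) | t <- s]; rewrite /lin_comb big_map scaler_sumr.
by apply: eq_bigr => t _; rewrite scalerA.
Qed.
Lemma spanned_sum I (r : seq I) (P : pred I) (F : I -> L) :
  (forall i, P i -> spanned (F i)) -> spanned (\sum_(i <- r | P i) F i).
Proof. by move=> h; elim/big_rec: _ => [|i x Pi]; [exact: spanned0 | apply: spannedD; exact: h]. Qed.

Lemma spanned_mul a b : (forall p q, spanned (a * (mm p * gg q))) ->
  spanned b -> spanned (a * b).
Proof.
move=> h [s ->]; rewrite mulr_sumr; apply: spanned_sum => t _.
by rewrite -scalerAr; apply: spannedZ.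
Qed.

(** Multiplying by one generator at a time avoids a product formula for two arbitrary monomials. *)
Lemma gen_spanned_mul a : gen X a -> forall b, spanned b -> spanned (a * b).
Proof.
have hv v b : spanned b -> spanned (pv X v * b).
  apply: spanned_mul => -[|e p] q.
    (* A vertex is not itself a monomial (the empty word gives [1]), so it is expanded over its
       outgoing edges. *)
    rewrite mm_nil mul1r pv_sum mulr_suml; apply: spanned_sum => e _.
    by rewrite -mulrA -mm1 -gg_rcons; exact: spanned1.
  rewrite mm_cons !mulrA pv_pe; case: ifP => _; rewrite ?mul0r; last exact: spanned0.
  by rewrite -mm_cons; exact: spanned1.
elim=> {a} [v|e|e||a b _ ha _ hb|c a _ ha|a b _ ha _ hb] x hx.
- exact: hv.
- apply: spanned_mul hx => p q; rewrite mulrA -mm_cons; exact: spanned1.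
- apply: spanned_mul hx => -[|f p] q.
    by rewrite mm_nil mul1r -gg_rcons -[gg _]mul1r -mm_nil; exact: spanned1.
  rewrite mm_cons !mulrA; have [_ -> _ _ _] := hX; case: eqP => _; last first.
    by rewrite !mul0r; exact: spanned0.
  by rewrite -mulrA; apply/hv/spanned1.
- by rewrite mul0r; exact: spanned0.
- by rewrite mulrDl; apply: spannedD; [exact: ha | exact: hb].
- by rewrite -scalerAl; apply/spannedZ/ha.
- by rewrite -mulrA; apply/ha/hb.
Qed.

Lemma gen_spanned a : gen X a -> spanned a.
Proof.
move=> ga; rewrite -(mulr1 a); apply: gen_spanned_mul => //.
by rewrite -[1]mulr1 -{1}mm_nil -gg_nil; exact: spanned1.
Qed.

Lemma spanned_ind (P : L -> Prop) : P 0 -> (forall a b, P a -> P b -> P (a + b)) ->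
  (forall c a, P a -> P (c *: a)) -> (forall p q, P (mm p * gg q)) ->
  forall a, spanned a -> P a.
Proof.
move=> P0 PD PZ Pm a [s ->]; elim: s => [|t s IHs]; rewrite /lin_comb ?big_nil //.
by rewrite big_cons; apply: PD => //; apply: PZ.
Qed.
End Monomials.

(** * Gradings *)

(** Finite support is phrased as a sum over every duplicate-free list containing the support, so
    that supports can be enlarged and merged. *)
Record grading (R : comNzRingType) (L : algType R) := Grading {
  gc : int -> L -> L;
  gcD : forall k x y, gc k (x + y) = gc k x + gc k y;
  gcZ : forall k c x, gc k (c *: x) = c *: gc k x;
  gc_gc : forall k l x, gc k (gc l x) = if k == l then gc l x else 0;
  gcM : forall k l x y, gc k x = x -> gc l y = y -> gc (k + l) (x * y) = x * y;
  gcS : forall x, exists s : seq int, forall t, uniq t -> {subset s <= t} ->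
    x = \sum_(k <- t) gc k x }.

Section GradingTheory.
Variables (R : comNzRingType) (L : algType R) (G : grading L).

Definition homog k x := gc G k x = x.

Lemma gc0 k : gc G k 0 = 0.
Proof. by rewrite -(scale0r 0) gcZ !scale0r. Qed.
Lemma gc_sum k I (r : seq I) (P : pred I) (F : I -> L) :
  gc G k (\sum_(i <- r | P i) F i) = \sum_(i <- r | P i) gc G k (F i).
Proof. exact: (big_morph (gc G k) (gcD G k) (gc0 k)). Qed.

Lemma homog_gc k x : homog k (gc G k x).
Proof. by rewrite /homog gc_gc eqxx. Qed.
Lemma gc_homog k d x : homog d x -> gc G k x = if k == d then x else 0.
Proof. by move=> <-; rewrite gc_gc. Qed.
Lemma homog0 k : homog k 0. Proof. exact: gc0. Qed.
Lemma homogZ k c x : homog k x -> homog k (c *: x).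
Proof. by move=> hx; rewrite /homog gcZ hx. Qed.
Lemma homogM k l x y : homog k x -> homog l y -> homog (k + l) (x * y).
Proof. exact: gcM. Qed.
Lemma homog_sum k I (r : seq I) (P : pred I) (F : I -> L) :
  (forall i, P i -> homog k (F i)) -> homog k (\sum_(i <- r | P i) F i).
Proof. by move=> h; rewrite /homog gc_sum; apply: eq_bigr. Qed.
Lemma homog_uniq k l x : homog k x -> homog l x -> x != 0 -> k = l.
Proof.
move=> hk hl; apply: contra_neq_eq => kl; move: hk; rewrite /homog (gc_homog _ hl).
by rewrite (negPf kl) => <-.
Qed.
Lemma homog_eq k l x : homog k x -> k = l -> homog l x.
Proof. by move=> h <-. Qed.

Lemma gc_mulr k b a : homog 0 b -> gc G k (a * b) = gc G k a * b.
Proof.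
move=> hb; have [s hs] := gcS G a.
rewrite (hs _ (undup_uniq s)); last by move=> x; rewrite mem_undup.
rewrite mulr_suml !gc_sum mulr_suml; apply: eq_bigr => l _.
rewrite (@gc_homog k l); last exact: homog_eq (homogM (homog_gc l a) hb) (addr0 l).
by rewrite gc_gc; case: eqP; rewrite ?mul0r.
Qed.
Lemma gc_mull k b a : homog 0 b -> gc G k (b * a) = b * gc G k a.
Proof.
move=> hb; have [s hs] := gcS G a.
rewrite (hs _ (undup_uniq s)); last by move=> x; rewrite mem_undup.
rewrite mulr_sumr !gc_sum mulr_sumr; apply: eq_bigr => l _.
rewrite (@gc_homog k l); last exact: homog_eq (homogM hb (homog_gc l a)) (add0r l).
by rewrite gc_gc; case: eqP; rewrite ?mulr0.
Qed.
End GradingTheory.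

Section Shift.
Variables (R : comNzRingType) (L : algType R).
Lemma shift_lin (a : L) (d : int) (c : R) (f g : int -> L) :
  (fun j => a * (c *: f (j - d) + g (j - d))) =
  (fun j => c *: (a * f (j - d)) + a * g (j - d)).
Proof. by apply: funext => j; rewrite mulrDr scalerAr. Qed.
Definition shift_op (a : L) (d : int) : op (0 : int) L :=
  @Op R int 0 L (fun f j => a * f (j - d)) (shift_lin a d).
Lemma shift_opE a d f j : shift_op a d f j = a * f (j - d). Proof. by []. Qed.
Lemma shift_opM a b d e : shift_op a d * shift_op b e = shift_op (a * b) (d + e).
Proof. by apply: opP => f j; rewrite op_mulE !shift_opE mulrA opprD addrA. Qed.
Lemma shift_op0 d : shift_op 0 d = 0.
Proof. by apply: opP => f j; rewrite shift_opE mul0r. Qed.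
Lemma shift_opD a b d : shift_op (a + b) d = shift_op a d + shift_op b d.
Proof. by apply: opP => f j; rewrite op_addE !shift_opE mulrDl. Qed.
Lemma shift_op_sum d I (r : seq I) (P : pred I) (F : I -> L) :
  shift_op (\sum_(i <- r | P i) F i) d = \sum_(i <- r | P i) shift_op (F i) d.
Proof. exact: (big_morph (shift_op^~ d) (fun a b => shift_opD a b d) (shift_op0 d)). Qed.
Lemma shift_opZ c a d : shift_op (c *: a) d = c *: shift_op a d.
Proof. by apply: opP => f j; rewrite op_scaleE !shift_opE scalerAl. Qed.
End Shift.

Section OwnGrading.
Variables (R : comNzRingType) (E : graph) (L : algType R) (X : LFamily E L).
Hypothesis hX : is_Leavitt_path_algebra X.
Hypothesis nosink : forall v : 'I_(nV E), exists e : edge E, src e = v.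

(* The family [v, e t, e^* t^-1] acting on [int -> L], where [t] is the shift. *)
Definition shift_family : LFamily E (op (0 : int) L) :=
  LFam (fun v => shift_op (pv X v) 0) (fun e => shift_op (pe X e) 1)
       (fun e => shift_op (pg X e) (-1)).

Lemma shift_familyP : is_Leavitt_family shift_family.
Proof.
have [[h1 h2 h3 h4 h5] _] := hX; split=> /=.
- by move=> v w; rewrite shift_opM h1; case: eqP; rewrite ?shift_op0.
- by move=> e f; rewrite shift_opM h2; case: eqP; rewrite ?shift_op0.
- by move=> e; rewrite !shift_opM add0r addr0; have [-> ->] := h3 e.
- by move=> e; rewrite !shift_opM add0r addr0; have [-> ->] := h4 e.
- move=> v /h5 ->; rewrite shift_op_sum; apply: eq_bigr => e _.
  by rewrite shift_opM.
Qed.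

(** The shift representation turns [a] into the sum of the [a_k t^k]. Applied to the function that
    is [1] at 0 and [0] elsewhere, its value at [k] is the component [a_k]. *)
Lemma own_grading : exists G : grading L, forall p q : seq (edge E),
  homog G ((size p)%:Z - (size q)%:Z) (mm X p * gg X q).
Proof.
have [hf hu] := hX.
have [rho [[[rD rZ rM] rv re rg] _]] := hu _ _ shift_familyP.
have r0 : rho 0 = 0 by rewrite -(scale0r 0) rZ scale0r.
(* [rho] is not assumed unital; its value at [1] comes from the decomposition of [1] into
   vertices. *)
have r1 : rho 1 = shift_op 1 0.
  rewrite (LPA_one hX) shift_op_sum (big_morph rho rD r0).
  by apply: eq_bigr => v _; rewrite rv.
pose hd d a := rho a = shift_op a d.
have hdM d e a b : hd d a -> hd e b -> hd (d + e) (a * b).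
  by rewrite /hd => ha hb; rewrite rM ha hb shift_opM.
have hmm p : hd (size p)%:Z (mm X p).
  elim/last_ind: p => [|p e IHp]; first by rewrite mm_nil.
  by rewrite mm_rcons size_rcons -addn1 PoszD; apply: hdM => //; exact: re.
have hgg p : hd (- (size p)%:Z) (gg X p).
  elim/last_ind: p => [|p e IHp]; first by rewrite gg_nil.
  rewrite gg_rcons size_rcons -add1n PoszD opprD; apply: hdM => //; exact: rg.
have hmg p q : hd ((size p)%:Z - (size q)%:Z) (mm X p * gg X q) by exact: hdM.
have sp a : spanned X a.
  exact: (gen_spanned hf nosink (LPA_gen hX a)).
pose del (j : int) : L := if j == 0 then 1 else 0.
pose pi k a := rho a del k.
have piD k x y : pi k (x + y) = pi k x + pi k y by rewrite /pi rD.
have piZ k c x : pi k (c *: x) = c *: pi k x by rewrite /pi rZ.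
have pihd k d a : hd d a -> pi k a = if k == d then a else 0.
  rewrite /pi /hd => ->; rewrite shift_opE /del subr_eq0.
  by case: eqP; rewrite ?mulr1 ?mulr0.
have pi0 k : pi k 0 = 0 by rewrite /pi r0.
have hd0 d : hd d 0 by rewrite /hd r0 shift_op0.
have hdpi k a : hd k (pi k a).
  elim/spanned_ind: {a}(sp a) => [|a b ha hb|c a ha|p q].
  - by rewrite pi0.
  - by rewrite piD /hd rD ha hb shift_opD.
  - by rewrite piZ /hd rZ ha shift_opZ.
  - by rewrite (pihd _ _ _ (hmg p q)); case: eqP => [->|_].
have pic k l x : pi k (pi l x) = if k == l then pi l x else 0.
  by rewrite (pihd _ _ _ (hdpi l x)).
have piM k l x y : pi k x = x -> pi l y = y -> pi (k + l) (x * y) = x * y.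
  move=> hx hy; rewrite (pihd _ (k + l)) ?eqxx //.
  by apply: hdM; [rewrite -hx | rewrite -hy].
have piS x : exists s : seq int, forall t, uniq t -> {subset s <= t} ->
    x = \sum_(k <- t) pi k x.
  elim/spanned_ind: {x}(sp x) => [|a b [s hs] [s' hs']|c a [s hs]|p q].
  - by exists [::] => t _ _; rewrite big1 // => k _; rewrite pi0.
  - exists (s ++ s') => t ut st; rewrite (eq_bigr _ (fun k _ => piD k a b)).
    rewrite big_split /=.
    by congr (_ + _); [apply: hs | apply: hs'] => // k ks; apply: st; rewrite mem_cat ks ?orbT.
  - by exists s => t ut st; rewrite (eq_bigr _ (fun k _ => piZ k c a)) -scaler_sumr -hs.
  - exists [:: (size p)%:Z - (size q)%:Z] => t ut st.
    rewrite (bigD1_seq ((size p)%:Z - (size q)%:Z)) ?st ?mem_head //=.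
    rewrite (pihd _ _ _ (hmg p q)) eqxx big1 ?addr0 // => k kn.
    by rewrite (pihd _ _ _ (hmg p q)) (negPf kn).
exists (Grading piD piZ pic piM piS) => p q.
by rewrite /homog /= (pihd _ _ _ (hmg p q)) eqxx.
Qed.

End OwnGrading.

(** * A linear functional with value 1 on every vertex *)

Section Functional.
Variables (R : comNzRingType) (E : graph).
Hypothesis nosink : forall v : 'I_(nV E), exists e : edge E, src e = v.
Variables (e0 : edge E).
Local Notation T := ('I_(nV E) * nat)%type.
Let t0 : T := (src e0, 0%N).

Lemma pull_lin (b : T -> bool) (s : T -> T) (c : R) (f g : T -> R^o) :
  (fun y => if b y then c *: f (s y) + g (s y) else 0) =
  (fun y => c *: (if b y then f (s y) else 0 : R^o) + (if b y then g (s y) else 0)).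
Proof. by apply: funext => y; case: (b y); rewrite ?scaler0 ?addr0. Qed.
Definition pull_op b s : op t0 R^o :=
  @Op R T t0 R^o (fun f y => if b y then f (s y) else 0) (pull_lin b s).
Lemma pull_opE b s f y : pull_op b s f y = if b y then f (s y) else 0. Proof. by []. Qed.

(* Numbering the edges leaving [v], the map [tail] identifies [{v} * nat] with the
   disjoint union of the [{rng e} * nat] over these edges; this branching system
   represents the Leavitt path algebra on functions. *)
Definition out_edges (v : 'I_(nV E)) := enum [pred e : edge E | src e == v].
Definition label (y : T) := nth e0 (out_edges y.1) (y.2 %% size (out_edges y.1)).
Definition tail (y : T) : T := (rng (label y), y.2 %/ size (out_edges y.1))%N.
Definition prepend (e : edge E) (y : T) : T :=
  (src e, y.2 * size (out_edges (src e)) + index e (out_edges (src e)))%N.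

Lemma mem_out e : e \in out_edges (src e). Proof. by rewrite mem_enum inE. Qed.
Lemma out_gt0 v : (0 < size (out_edges v))%N.
Proof. by have [e <-] := nosink v; case: (out_edges _) (mem_out e). Qed.
Lemma src_label y : src (label y) = y.1.
Proof.
apply/eqP; have: label y \in out_edges y.1 by rewrite mem_nth // ltn_mod out_gt0.
by rewrite mem_enum.
Qed.
Lemma label_prepend e y : label (prepend e y) = e.
Proof. by rewrite /label /= modnMDl modn_small ?index_mem ?mem_out // nth_index ?mem_out. Qed.
Lemma tail_prepend e y : y.1 = rng e -> tail (prepend e y) = y.
Proof.
case: y => v n /= ->; rewrite /tail label_prepend /= divnMDl ?out_gt0 //.
by rewrite divn_small ?addn0 // index_mem mem_out.
Qed.
Lemma prepend_tail y : prepend (label y) (tail y) = y.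
Proof.
case: y => v n; rewrite /prepend /tail src_label /=; congr pair.
rewrite /label /= index_uniq ?enum_uniq ?ltn_mod ?out_gt0 //.
by rewrite -divn_eq.
Qed.

Definition pull_family : LFamily E (op t0 R^o) :=
  LFam (fun v => pull_op (fun y => y.1 == v) id)
       (fun e => pull_op (fun y => label y == e) tail)
       (fun e => pull_op (fun y => y.1 == rng e) (prepend e)).

Lemma pull_familyP : is_Leavitt_family pull_family.
Proof.
split=> /=.
- move=> v w; apply: opP => f y; rewrite op_mulE !pull_opE.
  case: (eqVneq v w) => [<-|vw]; first by rewrite pull_opE; case: (y.1 == v).
  by case: eqP => // ->; rewrite (negPf vw).
- move=> e f; apply: opP => h y; rewrite op_mulE !pull_opE label_prepend.
  case: (eqVneq e f) => [_|_]; last by rewrite if_same.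
  by rewrite pull_opE; case: eqP => // ye; rewrite tail_prepend.
- move=> e; split; apply: opP => f y; rewrite op_mulE !pull_opE.
    by case: (eqVneq (label y) e) => [<-|_]; rewrite ?src_label ?eqxx ?if_same.
  by case: (eqVneq (label y) e) => [<-|_] //; rewrite /tail /= eqxx.
- move=> e; split; apply: opP => f y; rewrite op_mulE !pull_opE.
    by rewrite /prepend /= eqxx.
  by case: eqP.
- move=> v _; apply: opP => f y; rewrite op_sumE pull_opE.
  under eq_bigr => e _ do rewrite op_mulE !pull_opE.
  case: (eqVneq y.1 v) => yv.
    rewrite (bigD1 (label y)) /=; last by rewrite src_label yv.
    rewrite !eqxx prepend_tail big1 ?addr0 // => e /andP[_ ne].
    by rewrite eq_sym (negPf ne).
  rewrite big1 // => e /eqP ev; case: eqP => // ye.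
  by move: yv; rewrite -ev -ye src_label eqxx.
Qed.

(** Sum of the diagonal matrix coefficients at the points [(w, 0)]: a vertex [v] acts as restriction
    to its own points, so only [w = v] contributes. It will show that no nonzero scalar kills a
    vertex. *)
Lemma vertex_functional (L : algType R) (X : LFamily E L) :
  is_Leavitt_path_algebra X -> exists chi : L -> R,
  [/\ forall a b, chi (a + b) = chi a + chi b, forall c a, chi (c *: a) = c * chi a &
      forall v, chi (pv X v) = 1].
Proof.
move=> [hf hu]; have [rho [[[rD rZ rM] rv re rg] _]] := hu _ _ pull_familyP.
pose chi a := \sum_(w : 'I_(nV E)) (rho a (fun y => if y == (w, 0%N) then 1 else 0) (w, 0%N) : R).
exists chi; split.
- by move=> a b; rewrite /chi -big_split /=; apply: eq_bigr => w _; rewrite rD.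
- by move=> c a; rewrite /chi mulr_sumr; apply: eq_bigr => w _; rewrite rZ.
- move=> v; rewrite /chi (bigD1 v) //= rv pull_opE /= !eqxx big1 ?addr0 // => w wv.
  by rewrite ?rv ?pull_opE /= (negPf wv).
Qed.
End Functional.

(** * Normal forms and the diagonal *)

(** Collects what is drawn from universality, so that two families in one algebra can be treated
    alike. *)
Record frame (R : comNzRingType) (E : graph) (L : algType R) (X : LFamily E L) := Frame {
  fr_fam : is_Leavitt_family X;
  fr_nosink : forall v : 'I_(nV E), exists e : edge E, src e = v;
  fr_one : 1 = \sum_v pv X v;
  fr_span : forall a, spanned X a;
  fr_G : grading L;
  fr_homog : forall p q, homog fr_G ((size p)%:Z - (size q)%:Z) (mm X p * gg X q);
  fr_chi : L -> R;
  fr_chiD : forall a b, fr_chi (a + b) = fr_chi a + fr_chi b;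
  fr_chiZ : forall c a, fr_chi (c *: a) = c * fr_chi a;
  fr_chiv : forall v, fr_chi (pv X v) = 1 }.

Lemma frame_exists (R : comNzRingType) (E : graph) (L : algType R) (X : LFamily E L) :
  (forall v : 'I_(nV E), exists e : edge E, src e = v) ->
  is_Leavitt_path_algebra X -> inhabited (frame X).
Proof.
move=> ns hX; have [hf _] := hX; have one := LPA_one hX.
case: (pickP (mem (edge E))) => [e0 _|noedge]; last first.
  have /eqP : (1 : L) = 0.
    by rewrite one big1 // => v _; have [e _] := ns v; have := noedge e.
  by rewrite oner_eq0.
have [chi [chiD chiZ chiv]] := vertex_functional ns e0 hX.
have [G hG] := own_grading hX ns.
split; exists G chi => // a.
exact: (gen_spanned hf ns (LPA_gen hX a)).
Qed.

Section Frame.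
Variables (R : comNzRingType) (E : graph) (L : algType R) (X : LFamily E L).
Variable (fr : frame X).
Implicit Types (p q : seq (edge E)) (a b x y : L).
Let hf := fr_fam fr.
Let ns := fr_nosink fr.
Let one := fr_one fr.
Notation m := (mm X). Notation g := (gg X). Notation vr := (vtx X).
Notation W := (words (edge E)).
Local Notation G := (fr_G fr).

Lemma fr_words n : 1 = \sum_(p <- W n) m p * g p.
Proof. exact: (one_words hf ns one n). Qed.

Lemma homog_mg p q k : (size p)%:Z - (size q)%:Z = k -> homog G k (m p * g q).
Proof. by move=> <-; exact: fr_homog. Qed.

Lemma homog0_mg p : homog G 0 (m p * g p).
Proof. by apply: homog_mg; rewrite subrr. Qed.

Lemma homog_m p : homog G (size p)%:Z (m p).
Proof. by rewrite -[m p]mulr1 -(gg_nil X); apply: homog_mg; rewrite subr0. Qed.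
Lemma homog_g p : homog G (- (size p)%:Z) (g p).
Proof. by rewrite -[g p]mul1r -(mm_nil X); apply: homog_mg; rewrite sub0r. Qed.
Lemma homog_vtx p : homog G 0 (vr p).
Proof. by apply: homog_eq (homogM (homog_g p) (homog_m p)) _; rewrite addNr. Qed.

(** Passing to degree 0 first discards components on which [fr_chi] is uncontrolled. The result
    recovers the scalar [c] from [c *: vr p] when [p] is a nonempty path. *)
Definition deg0_coef x : R := fr_chi fr (gc G 0 x).
Local Notation c0 := deg0_coef.
Lemma c0D x y : c0 (x + y) = c0 x + c0 y. Proof. by rewrite /deg0_coef gcD fr_chiD. Qed.
Lemma c0Z c x : c0 (c *: x) = c * c0 x. Proof. by rewrite /deg0_coef gcZ fr_chiZ. Qed.
Lemma c00 : c0 0 = 0. Proof. by rewrite -(scale0r 0) c0Z mul0r. Qed.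
Lemma c0_vtx c p : p != [::] -> c0 (c *: vr p) = if pth p then c else 0.
Proof.
case/lastP: p => // p e _; rewrite c0Z /deg0_coef homog_vtx vtx_rcons //.
by case: ifP => _; rewrite ?fr_chiv ?mulr1 // -(scale0r 0) fr_chiZ mul0r mulr0.
Qed.

Lemma vtx_tf c p : p != [::] -> pth p -> c *: vr p = 0 -> c = 0.
Proof. by move=> p0 pp h; have := c0_vtx c p0; rewrite h pp c00. Qed.

Lemma vtx_neq0 p : p != [::] -> pth p -> vr p != 0.
Proof.
move=> p0 pp; apply/eqP => v0; have := @vtx_tf 1 p p0 pp.
by rewrite scale1r => /(_ v0)/eqP; rewrite oner_eq0.
Qed.

(* Spanned by the [m p * g q] with [size p = i], [size q = j] (when [0 < j]). *)
Definition scal i j b := forall p q, size p = i -> size q = j ->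
  exists c, g p * b * m q = c *: vr q.

Lemma scal0 i j : scal i j 0.
Proof. by move=> p q _ _; exists 0; rewrite mulr0 mul0r scale0r. Qed.
Lemma scalD i j a b : scal i j a -> scal i j b -> scal i j (a + b).
Proof.
move=> ha hb p q sp sq; have [c hc] := ha p q sp sq; have [d hd] := hb p q sp sq.
by exists (c + d); rewrite mulrDr mulrDl hc hd scalerDl.
Qed.
Lemma scalZ i j c b : scal i j b -> scal i j (c *: b).
Proof.
move=> hb p q sp sq; have [d hd] := hb p q sp sq.
by exists (c * d); rewrite -scalerAr -scalerAl hd scalerA.
Qed.
Lemma scal_mg p q : (0 < size q)%N -> scal (size p) (size q) (m p * g q).
Proof.
move=> q0 p' q' sp sq; rewrite mulrA -mulrA (gg_mm hf) // (gg_mm hf) //.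
case: eqP => [->|_]; last by exists 0; rewrite mul0r scale0r.
case: eqP => [<-|_]; last by exists 0; rewrite mulr0 scale0r.
case/lastP: q q0 {sq} => // q e _; case/lastP: p {sp} => [|p f].
  by exists 1; rewrite (vtx_nil X) mul1r scale1r.
rewrite !(vtx_rcons hf); case: ifP => _; last by exists 0; rewrite mul0r scale0r.
case: ifP => _; last by exists 0; rewrite mulr0 scale0r.
have [-> _ _ _ _] := hf; case: eqP => [->|_]; first by exists 1; rewrite scale1r.
by exists 0; rewrite scale0r.
Qed.

Lemma scalS i j b : scal i j b -> scal i.+1 j.+1 b.
Proof.
move=> hb p q; case/lastP: p => // p e; case/lastP: q => // q f.
rewrite !size_rcons => -[sp] [sq]; have [c hc] := hb p q sp sq.
rewrite gg_rcons mm_rcons !mulrA -(mulrA (pg X e)) -(mulrA (pg X e)) hc.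
rewrite -scalerAr -scalerAl; case: (eqVneq e f) => [<-|ef].
  by exists c; rewrite vtx_rconsE.
exists 0; rewrite scale0r -mulrA (vtx_pe hf); case: ifP => _; rewrite ?mulr0 ?scaler0 //.
by have [_ -> _ _ _] := hf; rewrite (negPf ef) scaler0.
Qed.

Lemma scalDn i j n b : scal i j b -> scal (i + n) (j + n) b.
Proof. by move=> h; elim: n => [|n IHn]; rewrite ?addn0 // !addnS; apply: scalS. Qed.

Lemma scal_gc k x : exists i j, i%:Z - j%:Z = k /\ scal i j (gc G k x).
Proof.
elim/spanned_ind: {x}(fr_span fr x) => [|a b [i [j [ij ha]]] [i' [j' [ij' hb]]]|
  c a [i [j [ij ha]]]|p q].
(* The least natural numbers with difference [k]. *)
- by exists `|Num.max k 0|%N, `|Num.max (- k) 0|%N; split; [lia | rewrite gc0; exact: scal0].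
- exists (i + i')%N, (j + i')%N; split; first by rewrite -ij; lia.
  rewrite gcD; apply: scalD; first exact: scalDn.
  have -> : (i + i' = i' + i)%N by exact: addnC.
  have -> : (j + i' = j' + i)%N by lia.
  exact: scalDn.
- by exists i, j; split => //; rewrite gcZ; apply: scalZ.
- rewrite (gc_homog k (fr_homog fr p q)); case: eqP => [->|_].
    (* Both words get one more letter because [scal_mg] requires a nonempty second word. *)
    exists (size p).+1, (size q).+1; split; first by lia.
    rewrite (mg_words2 hf ns one p q 1) sum_wordsS big_seq1.
    elim/big_rec: _ => [|e x _ hx]; first exact: scal0.
    apply: scalD => //=; rewrite !cats1 -!(size_rcons _ e); apply: scal_mg.
    by rewrite size_rcons.
  by exists `|Num.max k 0|%N, `|Num.max (- k) 0|%N; split; [lia | exact: scal0].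
Qed.

Lemma homog_scal k x : homog G k x ->
  exists i j, [/\ i%:Z - j%:Z = k, (0 < i)%N, (0 < j)%N & scal i j x].
Proof.
move=> <-; have [i [j [ij h]]] := scal_gc k x; exists i.+1, j.+1.
by split; rewrite ?ltnS //; [lia | apply: scalS].
Qed.

Lemma expand i j x : x = \sum_(p <- W i) \sum_(q <- W j) m p * (g p * x * m q) * g q.
Proof.
rewrite -{1}(mul1r x) -{1}(mulr1 (1 * x)) {1}(fr_words i) {1}(fr_words j) !mulr_suml.
apply: eq_bigr => p _; rewrite mulr_sumr; apply: eq_bigr => q _.
by rewrite !mulrA.
Qed.

(** Level [n] of the diagonal. Levels increase with [n], and every element of the diagonal lies in
    one of them. *)
Definition diagonal n x := exists c : seq (edge E) -> R,
  x = \sum_(p <- W n) c p *: (m p * g p).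

Lemma diagonalD n x y : diagonal n x -> diagonal n y -> diagonal n (x + y).
Proof.
move=> [c ->] [d ->]; exists (fun p => c p + d p); rewrite -big_split /=.
by apply: eq_bigr => p _; rewrite scalerDl.
Qed.
Lemma diagonalZ n c x : diagonal n x -> diagonal n (c *: x).
Proof.
move=> [d ->]; exists (fun p => c * d p); rewrite scaler_sumr.
by apply: eq_bigr => p _; rewrite scalerA.
Qed.
Lemma diagonal0 n : diagonal n 0.
Proof. by exists (fun=> 0); rewrite big1 // => p _; rewrite scale0r. Qed.
Lemma diagonal_sum n I (r : seq I) (P : pred I) (F : I -> L) :
  (forall i, P i -> diagonal n (F i)) -> diagonal n (\sum_(i <- r | P i) F i).
Proof.
by move=> h; elim/big_rec: _ => [|i x Pi]; [exact: diagonal0 | apply: diagonalD; exact: h].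
Qed.
Lemma diagonal_mg p : diagonal (size p) (m p * g p).
Proof.
exists (fun q => if q == p then 1 else 0).
rewrite (@sum_words1 _ _ _ p) ?eqxx ?scale1r // => q _ /negPf ->.
by rewrite scale0r.
Qed.
Lemma diagonal_add n k x : diagonal n x -> diagonal (n + k) x.
Proof.
move=> [c ->]; exists (fun q => c (take n q)); rewrite sum_wordsD.
apply: eq_sum_words => p sp; rewrite (mg_words hf ns one p k) scaler_sumr.
by apply: eq_bigr => q _; rewrite take_size_cat.
Qed.
Lemma diagonal_le n n' x : (n <= n')%N -> diagonal n x -> diagonal n' x.
Proof. by move=> /subnKC <-; exact: diagonal_add. Qed.

Lemma diagonal_homog n x : diagonal n x -> homog G 0 x.
Proof. by move=> [c ->]; apply: homog_sum => p _; apply: homogZ; exact: homog0_mg. Qed.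

Lemma diagonal_coef n (c : seq (edge E) -> R) p q : size p = n -> size q = n ->
  g p * (\sum_(r <- W n) c r *: (m r * g r)) * m q = if p == q then c p *: vr p else 0.
Proof.
move=> sp sq; rewrite mulr_sumr mulr_suml.
rewrite (@sum_words1 _ _ _ p) // => [|r sr rp].
  rewrite -scalerAr -scalerAl !mulrA -(mulrA (g p * m p)) !(gg_mm hf) ?eqxx ?sp //.
  by case: eqP => _; rewrite ?mulr0 ?scaler0 // (vtx_vtx hf).
rewrite -scalerAr -scalerAl !mulrA (gg_mm hf) ?sp // eq_sym (negPf rp).
by rewrite !mul0r scaler0.
Qed.

Lemma diagonal_scal n x : diagonal n x -> scal n n x.
Proof.
move=> [c ->] p q sp sq; rewrite diagonal_coef //; case: eqP => [->|_].
  by exists (c q).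
by exists 0; rewrite scale0r.
Qed.

Lemma diagonal_off n x p q : diagonal n x -> size p = n -> size q = n -> p != q ->
  g p * x * m q = 0.
Proof. by move=> [c ->] sp sq /negPf pq; rewrite diagonal_coef // pq. Qed.

Lemma scal_diagonal n x : (0 < n)%N -> scal n n x ->
  (forall p q, size p = n -> size q = n -> p != q -> g p * x * m q = 0) -> diagonal n x.
Proof.
move=> n0 hs off; exists (fun p => c0 (g p * x * m p)).
rewrite {1}(expand n n x); apply: eq_sum_words => p sp.
rewrite (@sum_words1 _ _ _ p) // => [|q sq pq]; last first.
  by rewrite off ?mulr0 ?mul0r // eq_sym.
have [c ->] := hs p p sp sp; rewrite c0_vtx -?size_eq0 ?sp -?lt0n //.
rewrite -scalerAr (mm_vtx hf) -scalerAl; case: ifP => // /negbT/(mm_not_pth hf) ->.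
by rewrite mul0r !scaler0.
Qed.

Lemma mg_orth p q : size p = size q ->
  (m p * g p) * (m q * g q) = if p == q then m p * g p else 0.
Proof.
move=> s; rewrite !mulrA -(mulrA (m p)) (gg_mm hf) //; case: eqP => [->|_].
  by rewrite (mm_vtx hf).
by rewrite mulr0 mul0r.
Qed.

Lemma mg_idem p : (m p * g p) * (m p * g p) = m p * g p.
Proof. by rewrite mg_orth ?eqxx. Qed.

Lemma diagonal_comm n n' x y : diagonal n x -> diagonal n' y -> x * y = y * x.
Proof.
move=> /(diagonal_le (leq_addr n' n)) [c ->] /(diagonal_le (leq_addl n n')) [d ->].
set k := (n + n')%N; rewrite !mulr_suml; apply: eq_sum_words => p sp.
rewrite !mulr_sumr [LHS](@sum_words1 _ _ _ p) // => [|q sq qp]; last first.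
  by rewrite -scalerAl -scalerAr mg_orth ?sp // eq_sym (negPf qp) !scaler0.
rewrite [RHS](@sum_words1 _ _ _ p) // => [|q sq qp]; last first.
  by rewrite -scalerAl -scalerAr mg_orth ?sp // eq_sym (negPf qp) !scaler0.
by rewrite -!scalerAl -!scalerAr !scalerA mulrC.
Qed.

Lemma mm_gg_mm p : m p * g p * m p = m p.
Proof. by rewrite -mulrA (mm_vtx hf). Qed.

Lemma mg_neq0 p q : q != [::] -> pth q -> vr p = vr q -> m p * g q != 0.
Proof.
move=> q0 pq pvq; apply/eqP => h0; have /eqP := vtx_neq0 q0 pq; apply.
have -> : vr q = g p * (m p * g q) * m q.
  by rewrite -(vtx_vtx hf q) -{1}pvq /vtx !mulrA.
by rewrite h0 mulr0 mul0r.
Qed.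

Lemma in_diagonal_diagonal x : in_diagonal X x -> exists n, diagonal n x.
Proof.
move=> [s [hs ->]]; elim: s hs => [|[c [v p]] s IHs] /=.
  by exists 0%N; rewrite big_nil; exact: diagonal0.
case/andP=> _ /IHs [n hn]; rewrite big_cons /=.
have [k hk] : exists k, diagonal k (diag_gen X v p).
  case: p => [|e p] /=; last by exists (size (e :: p)); exact: diagonal_mg.
  exists 1%N; rewrite (pv_sum hf ns); apply: diagonal_sum => e _.
  by rewrite -mm1 -gg1; exact: (diagonal_mg [:: e]).
exists (k + n)%N; apply: diagonalD; first by apply/diagonal_add/diagonalZ.
exact: diagonal_le (leq_addl _ _) hn.
Qed.

Lemma scal_tf i j c x : (forall a b : R, a * b = 0 -> a = 0 \/ b = 0) ->
  (0 < j)%N -> scal i j x -> c *: x = 0 -> c = 0 \/ x = 0.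
Proof.
move=> dom j0 hx cx; case: (pselect (c = 0)) => [|c_neq0]; [by left | right].
rewrite (expand i j x); rewrite big_seq big1 // => p; rewrite mem_words => /eqP sp.
rewrite big_seq big1 // => q; rewrite mem_words => /eqP sq.
have [d hd] := hx p q sp sq; rewrite hd; case: (boolP (pth q)) => [pq|/(vtx_not_pth hf) ->].
  have q0 : q != [::] by rewrite -size_eq0 sq -lt0n.
  have /(vtx_tf q0 pq)/dom[//|->] : (c * d) *: vr q = 0.
    by rewrite -scalerA -hd scalerAl scalerAr cx mulr0 mul0r.
  by rewrite scale0r mulr0 mul0r.
by rewrite scaler0 mulr0 mul0r.
Qed.

(** Each homogeneous component is determined by entries that are multiples of vertices, on which
    scalars act faithfully. *)
Lemma torsion_free c x : (forall a b : R, a * b = 0 -> a = 0 \/ b = 0) ->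
  c *: x = 0 -> c = 0 \/ x = 0.
Proof.
move=> dom cx; case: (pselect (c = 0)) => [|c0]; [by left | right].
have [s hs] := gcS G x; rewrite (hs _ (undup_uniq s)); last by move=> k; rewrite mem_undup.
rewrite big1 // => k _; have [i [j [_ _ j0 h]]] := homog_scal (homog_gc G k x).
have /(scal_tf dom j0 h) [] // : c *: gc G k x = 0 by rewrite -gcZ cx gc0.
Qed.
End Frame.

(** * The commutant of the diagonal *)

Section Branching.
Variable (E : graph).
Hypothesis nosink : forall v : 'I_(nV E), exists e : edge E, src e = v.
Hypothesis condL : condition_L E.

Lemma path_extension n (e : edge E) :
  exists l, size l = n /\ path (@succ_edge E) e l.
Proof.
elim: n e => [|n IHn] e; first by exists [::].
have [f fe] := nosink (rng e); have [l [sl pl]] := IHn f.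
by exists (f :: l); rewrite /= sl pl /succ_edge fe eqxx.
Qed.

(** Condition (L) concerns cycles without repeated vertices; between two visits of the same vertex a
    closed path contains a shorter closed path. *)
Lemma simple_subcycle (c : seq (edge E)) : c != [::] -> cycle (@succ_edge E) c ->
  exists c', is_cycle c' /\ {subset c' <= c}.
Proof.
have [n] := ubnP (size c); elim: n c => // n IHn c cn c0 cyc.
case: (boolP (uniq (map (@src E) c))) => [uc|]; first by exists c; split.
have [e _] : exists e : edge E, True by case: c c0 {cn cyc} => [//|e l _]; exists e.
case/(uniqPn (src e)) => i [j [ij js]]; rewrite size_map in js.
have is_ := ltn_trans ij js; rewrite !(nth_map e) // => eqs.
pose a := take i c; pose d := drop i c; pose c1 := take (j - i) d; pose b := drop (j - i) d.
have dE : d = nth e c i :: drop i.+1 c by rewrite /d (drop_nth e).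
have bE : b = nth e c j :: drop j.+1 c.
  by rewrite /b /d drop_drop subnK ?(ltnW ij) // (drop_nth e).
have c1E : exists r, c1 = nth e c i :: r.
  rewrite /c1 dE; have : (0 < j - i)%N by rewrite subn_gt0.
  by case: (j - i)%N => // k _; eexists.
have [r c1r] := c1E.
have cE : c = a ++ (c1 ++ b) by rewrite !cat_take_drop.
have cyc1 : cycle (@succ_edge E) c1.
  move: cyc; rewrite -(rot_cycle (size a)) cE rot_size_cat -catA c1r bE /= rcons_path cat_path /=.
  case/andP=> /andP[pr /andP[sl _]] _; rewrite rcons_path pr /=.
  by move: sl; rewrite /succ_edge eqs.
have sub1 : {subset c1 <= c} by move=> x; rewrite cE !mem_cat => ->; rewrite orbT.
have [|||c' [hc' sub]] := IHn c1.
- have : (size c1 < size c)%N by rewrite cE !size_cat bE /= ; lia.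
  by move: cn; rewrite ltnS => cn /leq_trans; apply.
- by rewrite c1r.
- by [].
by exists c'; split => // x /sub/sub1.
Qed.

(** If [d] were the only continuation of its length, no vertex on it could have an exit, against
    Condition (L) for a simple cycle inside [d]. *)
Lemma branching (e : edge E) (d : seq (edge E)) : d != [::] ->
  path (@succ_edge E) e d -> rng (last e d) = rng e ->
  exists h, [/\ size h = size d, h != d & path (@succ_edge E) e h].
Proof.
move=> d0 pd ld; apply: contrapT => noh.
have hs i f x : (i < size d)%N -> src f = src (nth x d i) -> f = nth x d i.
  move=> id sf; apply: contrapT => nf.
  (* A different edge [f] at position [i], extended arbitrarily to the length of [d], would be
     another continuation. *)
  have [l [sl pl]] := path_extension (size d - i).-1 f.
  apply: noh; exists (take i d ++ f :: l); split.
  - by rewrite size_cat size_take id /= sl; lia.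
  - apply/eqP => /(congr1 (nth x ^~ i)).
    by rewrite nth_cat size_take id ltnn subnn.
  - move: pd; rewrite -{1}(cat_take_drop i d) (drop_nth x) // !cat_path /=.
    by case/andP=> -> /andP[+ _]; rewrite pl andbT /succ_edge sf.
have cyc : cycle (@succ_edge E) d.
  case: d d0 pd ld {noh hs} => // f d _ /= /andP[ef pd] ld.
  by rewrite rcons_path pd /= /succ_edge ld.
have [c' [hc' sub]] := simple_subcycle d0 cyc.
have [f [i [ic [sf nf]]]] := condL hc'.
apply: nf; have /sub/(nthP f)[k kd kE] : nth f c' i \in c' by exact: mem_nth.
by rewrite -kE; apply: hs; rewrite // kE.
Qed.

Lemma branching_pth (q d : seq (edge E)) (e : edge E) : d != [::] ->
  pth (rcons q e ++ d) -> rng (last e d) = rng e ->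
  exists h, [/\ size h = size d, h != d & pth (rcons q e ++ h)].
Proof.
move=> d0 pd ld.
have split_pth l : pth (rcons q e ++ l) = pth (rcons q e) && path (@succ_edge E) e l.
  by case: q {pd} => [|x q] //=; rewrite cat_path last_rcons.
rewrite split_pth in pd; case/andP: pd => pq pd.
have [h [sh nh ph]] := branching d0 pd ld.
by exists h; rewrite split_pth pq.
Qed.
End Branching.

Section Commutant.
Variables (R : comNzRingType) (E : graph) (L : algType R) (X : LFamily E L).
Variable (fr : frame X).
Hypothesis condL : condition_L E.
Implicit Types (p q : seq (edge E)) (a b x y : L).
Let hf := fr_fam fr.
Let ns := fr_nosink fr.
Notation m := (mm X). Notation g := (gg X). Notation vr := (vtx X).
Local Notation G := (fr_G fr).

(** Commutation with the projection of [q] forces a nonzero entry at [(p, q)] to have [p = q d] with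
    [d] a nonempty closed path. If [h] is another continuation of the length of [d], the entry at
    [(p h, q h)] is still nonzero, whereas commutation with the projection of [q h] would require
    [q d h] to start with [q h]. *)
Lemma commutant_pos i j b : (0 < j)%N -> (j < i)%N -> scal X i j b ->
  (forall q, b * (m q * g q) = (m q * g q) * b) -> b = 0.
Proof.
move=> j0 ji hb comm.
have bm q : b * m q = m q * g q * (b * m q) by rewrite mulrA -comm -mulrA (mm_gg_mm fr).
rewrite (expand fr i j b) big_seq big1 // => p.
rewrite mem_words => /eqP sp; rewrite big_seq big1 // => q; rewrite mem_words => /eqP sq.
have [c hc] := hb p q sp sq; rewrite hc.
suff -> : c *: vr q = 0 by rewrite mulr0 mul0r.
apply: contrapT => /eqP cn.
have gpq : g p * m q != 0.
  apply/eqP => h0; case/eqP: cn.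
  by rewrite -hc -mulrA bm !mulrA h0 !mul0r.
have pE : p = q ++ drop j p.
  rewrite -{1}(cat_take_drop j p); congr (_ ++ _); apply: contra_neq_eq gpq.
  rewrite -{2}(cat_take_drop j p) gg_cat -mulrA (gg_mm hf) ?size_take ?sp ?ji ?sq //.
  by move/negPf => ->; rewrite mulr0.
set d := drop j p in pE.
have d0 : d != [::] by rewrite -size_eq0 size_drop sp subn_eq0 -ltnNge.
case/lastP: q => [|q e] in sq pE hc cn comm gpq *; first by rewrite -sq in j0.
have pp : pth p by apply: contraT => /(gg_not_pth hf) h; move: gpq; rewrite h mul0r eqxx.
have pq : pth (rcons q e) by move: pp; rewrite pE => /pth_cat1.
have prE : vr p = pv X (rng (last e d)).
  case/lastP: d pE {d0} => [|d f] pE.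
    by rewrite pE cats0 (vtx_rcons hf) pq.
  by rewrite last_rcons pE -rcons_cat (vtx_rcons hf) rcons_cat -pE pp.
(* Otherwise the end vertices of [p] and [q] are orthogonal and the entry vanishes. *)
have ld : rng (last e d) = rng e.
  apply/eqP; apply: contraTT cn => nl; rewrite negbK -hc.
  have -> : g p * b * m (rcons q e) = vr p * (g p * b * m (rcons q e)).
    by rewrite !mulrA (vtx_gg hf).
  rewrite hc -scalerAr prE (vtx_rcons hf) pq.
  by have [-> _ _ _ _] := hf; rewrite (negPf nl) scaler0.
have ppd : pth (rcons q e ++ d) by rewrite -pE.
have [h [sh nh ph]] := branching_pth ns condL d0 ppd ld.
have ne : c *: vr (rcons q e ++ h) != 0.
  have cn0 : c != 0 by apply: contraNneq cn => ->; rewrite scale0r.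
  apply: contra cn0 => /eqP v0; rewrite (vtx_tf fr _ ph v0) //.
  by rewrite -size_eq0 size_cat size_rcons.
have hch : g (p ++ h) * b * m (rcons q e ++ h) = c *: vr (rcons q e ++ h).
  have -> : g (p ++ h) * b * m (rcons q e ++ h) = g h * (g p * b * m (rcons q e)) * m h.
    by rewrite gg_cat mm_cat !mulrA.
  by rewrite hc vtx_cat -scalerAr -scalerAl.
case/eqP: ne; rewrite -hch -mulrA bm !mulrA.
suff -> : g (p ++ h) * m (rcons q e ++ h) = 0 by rewrite !mul0r.
have -> : g (p ++ h) * m (rcons q e ++ h) = g (d ++ h) * (vr (rcons q e) * m h).
  by rewrite pE -catA gg_cat mm_cat /vtx !mulrA.
have -> : vr (rcons q e) * m h = m h.
  have [f [h' hE]] : exists f h', h = f :: h'.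
    by case: h sh {nh ph hch} => [|f h' _]; [case: (d) d0 | exists f, h'].
  rewrite hE mm_cons mulrA (vtx_pe hf).
  suff -> : pth (rcons (rcons q e) f) by [].
  by move: ph; rewrite hE -cat_rcons => /pth_cat1.
by rewrite gg_cat -mulrA (gg_mm hf) ?sh // eq_sym (negPf nh) mulr0.
Qed.

End Commutant.

Lemma eventually_all (T : eqType) (s : seq T) (P : T -> nat -> Prop) :
  (forall x, x \in s -> exists n0, forall n, (n0 <= n)%N -> P x n) ->
  exists n0, forall n, (n0 <= n)%N -> forall x, x \in s -> P x n.
Proof.
elim: s => [|x s IHs] h; first by exists 0%N.
have [n1 h1] := h x (mem_head x s).
have [y ys|n2 h2] := IHs; first by apply: h; rewrite inE ys orbT.
exists (maxn n1 n2) => n; rewrite geq_max => /andP[le1 le2] y.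
by rewrite inE => /predU1P[->|ys]; [exact: h1 | exact: h2].
Qed.

Section Star.
Variables (R : comNzRingType) (E : graph) (L : algType R) (X : LFamily E L).
Variables (conjR : R -> R) (st : L -> L).
Hypothesis hst : is_LPA_involution conjR X st.
Implicit Types (p q : seq (edge E)) (a b x y : L).

Lemma stD x y : st (x + y) = st x + st y. Proof. by have [] := hst. Qed.
Lemma stZ c x : st (c *: x) = conjR c *: st x. Proof. by have [] := hst. Qed.
Lemma stM x y : st (x * y) = st y * st x. Proof. by have [] := hst. Qed.
Lemma stK x : st (st x) = x. Proof. by have [] := hst. Qed.
Lemma st0 : st 0 = 0. Proof. by have /eqP := stD 0 0; rewrite addr0 -subr_eq subrr eq_sym => /eqP. Qed.
Lemma st1 : st 1 = 1. Proof. by rewrite -[LHS]mulr1 -{2}(stK 1) -stM mulr1 stK. Qed.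
Lemma st_mm p : st (mm X p) = gg X p.
Proof.
have [_ _ _ _ [_ ste]] := hst; elim: p => [|e p IHp]; first by rewrite mm_nil gg_nil st1.
by rewrite mm_cons gg_cons stM IHp ste.
Qed.
Lemma st_mg p q : st (mm X p * gg X q) = mm X q * gg X p.
Proof. by rewrite stM -(st_mm q) stK st_mm. Qed.

Variable (fr : frame X).
Local Notation G := (fr_G fr).

Lemma mg_projection p : is_projection st (mm X p * gg X p).
Proof. by split; [exact: (mg_idem fr) | exact: st_mg]. Qed.

Lemma st_gc k x : gc G (- k) (st x) = st (gc G k x).
Proof.
elim/spanned_ind: {x}(fr_span fr x) => [|a b ha hb|c a ha|p q].
- by rewrite gc0 st0 gc0.
- by rewrite gcD !stD gcD ha hb.
- by rewrite gcZ !stZ gcZ ha.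
- rewrite st_mg !(gc_homog _ (fr_homog _ _ _)) -[in RHS]eqr_opp opprB.
  by case: eqP => _; rewrite ?st0 ?st_mg.
Qed.

Lemma homog_st k x : homog G k x -> homog G (- k) (st x).
Proof. by move=> h; rewrite /homog st_gc h. Qed.

Hypothesis condL : condition_L E.

(** The components of [b] commute with the diagonal as well. Positive degrees vanish by
    [commutant_pos], negative ones after applying the involution, and in degree 0 commutation kills
    the off-diagonal entries. *)
Lemma commutant_diagonal b :
  (forall q, b * (mm X q * gg X q) = (mm X q * gg X q) * b) -> exists n, diagonal X n b.
Proof.
move=> comm; have hf := fr_fam fr.
have commk k q : gc G k b * (mm X q * gg X q) = (mm X q * gg X q) * gc G k b.
  by rewrite -gc_mulr ?comm ?gc_mull //; exact: homog0_mg.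
have pos k y : 0 < k -> homog G k y ->
    (forall q, y * (mm X q * gg X q) = (mm X q * gg X q) * y) -> y = 0.
  move=> k0 hy cy; have [i [j [ij i0 j0 h]]] := homog_scal hy.
  apply: (commutant_pos fr condL j0 _ h) => //; lia.
have gk k : k != 0 -> gc G k b = 0.
  move=> k0; case: (ltrP 0 k) => [kp|kn].
    by apply: (pos k) => //; exact: homog_gc.
  rewrite -[LHS]stK (pos (- k) (st (gc G k b))) ?st0 //.
  - lia.
  - exact/homog_st/homog_gc.
  - by move=> q; rewrite -st_mg -!stM commk.
have bE : b = gc G 0 b.
  have [s hs] := gcS G b; rewrite {1}(hs (undup (0 :: s))) ?undup_uniq //; last first.
    by move=> k ks; rewrite mem_undup inE ks orbT.
  by rewrite (bigD1_seq 0) ?undup_uniq ?mem_undup ?mem_head //= big1 ?addr0.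
have [i [j [ij i0 j0 h]]] := homog_scal (homog_gc G 0 b).
have {}ij : i = j by lia.
rewrite ij in h i0; exists j; rewrite bE; apply: (scal_diagonal fr) => // p q sp sq pq.
have bm : gc G 0 b * mm X q = mm X q * gg X q * (gc G 0 b * mm X q).
  by rewrite mulrA -commk -mulrA (mm_gg_mm fr).
by rewrite -mulrA bm !mulrA (gg_mm hf) ?sp // (negPf pq) !mul0r.
Qed.
End Star.

(** * Two Leavitt families on one algebra *)

Section TwoFamilies.
Variables (R : comNzRingType) (E F : graph) (L : algType R).
Variables (X : LFamily E L) (Y : LFamily F L) (conjR : R -> R) (st : L -> L).
Hypothesis dom : forall a b : R, a * b = 0 -> a = 0 \/ b = 0.
Hypothesis hstX : is_LPA_involution conjR X st.
Variables (frX : frame X) (frY : frame Y).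
Hypothesis condL : condition_L E.
Hypothesis hproj : forall p : L, is_projection st p -> in_diagonal Y p.
Implicit Types (p : seq (edge F)) (a b x y : L).
Notation m := (mm Y). Notation g := (gg Y). Notation vr := (vtx Y).
Local Notation GX := (fr_G frX).
Let hf := fr_fam frY.

Lemma mgX_diagonal q : exists n, diagonal Y n (mm X q * gg X q).
Proof.
apply: (in_diagonal_diagonal frY); apply: hproj.
exact: (mg_projection hstX frX).
Qed.

Lemma diagonal_XY n x : diagonal X n x -> exists n', diagonal Y n' x.
Proof.
move=> [c ->]; elim: (words _ _) => [|p s [n' IHs]].
  by exists 0%N; rewrite big_nil; exact: diagonal0.
have [k hk] := mgX_diagonal p; exists (k + n')%N; rewrite big_cons; apply: diagonalD.
  by apply: (diagonal_add frY); exact: diagonalZ.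
exact: (diagonal_le frY (leq_addl _ _) IHs).
Qed.

(** The diagonal of [Y] is commutative and contains that of [X]; its elements thus lie in the
    commutant of the latter. *)
Lemma diagonal_YX n x : diagonal Y n x -> exists n', diagonal X n' x.
Proof.
move=> hx; apply: (commutant_diagonal hstX frX condL) => q.
by have [n' hq] := mgX_diagonal q; exact: (diagonal_comm frY hx hq).
Qed.

Lemma homogX_diagonal n x : diagonal Y n x -> homog GX 0 x.
Proof. by move=> /diagonal_YX [n']; exact: diagonal_homog. Qed.

Lemma homogX_mg p : homog GX 0 (m p * g p).
Proof. exact: homogX_diagonal (diagonal_mg Y p). Qed.

Lemma edge_component (f : edge F) k : exists n, diagonal Y n (pg Y f * gc GX k (pe Y f)) /\
  gc GX k (pe Y f) = pe Y f * (pg Y f * gc GX k (pe Y f)).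
Proof.
set ak := gc GX k (pe Y f).
have fff : pe Y f * (pg Y f * pe Y f) = pe Y f by have := mm_vtx hf [:: f]; rewrite /vtx mm1 gg1.
have gfg : pg Y f * pe Y f * pg Y f = pg Y f by have := vtx_gg hf [:: f]; rewrite /vtx mm1 gg1.
have ffa : ak = pe Y f * pg Y f * ak.
  rewrite -gc_mull; last by rewrite -mm1 -gg1; exact: homogX_mg.
  by rewrite -mulrA fff.
have cv n x : diagonal Y n x -> x * (pg Y f * pe Y f) = pg Y f * pe Y f * x.
  move=> hx; have [_ -> _ _ _] := hf; rewrite eqxx (pv_sum hf (fr_nosink frY)).
  apply: (diagonal_comm frY hx (n' := 1)); apply: diagonal_sum => e _.
  by rewrite -mm1 -gg1; exact: (diagonal_mg Y [:: e]).
have commY n d : diagonal Y n d -> homog GX 0 (pe Y f * d * pg Y f) ->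
    (pg Y f * ak) * d = d * (pg Y f * ak).
  move=> hd he; have hd0 := homogX_diagonal hd.
  have fd : pe Y f * d = pe Y f * d * pg Y f * pe Y f.
    by rewrite -!mulrA (cv _ _ hd) !mulrA -(mulrA (pe Y f) (pg Y f)) fff.
  (* The degree [k] component of [f d = f d f^* f], as [d] and [f d f^*] have degree 0. *)
  have ad : ak * d = pe Y f * d * pg Y f * ak.
    by rewrite /ak -gc_mulr // -gc_mull // -fd.
  rewrite -mulrA ad !mulrA -(cv _ _ hd) -!mulrA (mulrA (pg Y f)) (mulrA (pg Y f * _)).
  by rewrite gfg.
have comm_mg p : (pg Y f * ak) * (m p * g p) = (m p * g p) * (pg Y f * ak).
  apply: (commY _ _ (diagonal_mg Y p)).
  by rewrite mulrA -mm_cons -mulrA -gg_cons; exact: homogX_mg.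
have [|n hn] := @commutant_diagonal _ _ _ _ _ _ hstX frX condL (pg Y f * ak).
  move=> q; have [n [c ->]] := mgX_diagonal q; rewrite mulr_sumr mulr_suml.
  by apply: eq_bigr => p _; rewrite -scalerAr comm_mg scalerAl.
have [n' hn'] := diagonal_XY hn.
by exists n'; split => //; rewrite mulrA.
Qed.

(** At a level containing the finitely many nonzero [f^* f_k], each [f_k p p^*] is a multiple of
    [f p p^*]. If one multiple is nonzero, torsion-freeness makes [f p p^*] itself homogeneous. *)
Lemma edge_weights : exists M, forall (f : edge F) p, size p = M.+1 ->
  exists d, homog GX d (m (f :: p) * g p).
Proof.
pose P (f : edge F) n := forall p, size p = n -> exists d, homog GX d (m (f :: p) * g p).
suff [n hn] : exists n, forall n', (n <= n')%N -> forall f, f \in enum (edge F) -> P f n'.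
  by exists n => f p sp; apply: (hn n.+1) => //; rewrite ?mem_enum.
apply: eventually_all => f _; have [s hs] := gcS GX (pe Y f).
have := @eventually_all _ (undup s) (fun k n => diagonal Y n (pg Y f * gc GX k (pe Y f))).
case=> [k _|n hn].
  have [n [hn _]] := edge_component f k.
  by exists n => n' nn'; exact: (diagonal_le frY nn' hn).
exists n => n' nn' p sp.
have fpE : m (f :: p) * g p = \sum_(k <- undup s) gc GX k (pe Y f) * (m p * g p).
  rewrite -mulr_suml -hs ?undup_uniq ?mm_cons ?mulrA // => k.
  by rewrite mem_undup.
have cE k : k \in undup s -> exists c, gc GX k (pe Y f) * (m p * g p) = c *: (m (f :: p) * g p).
  move=> ks; have [c hc] := hn n' nn' k ks; have [_ [_ ->]] := edge_component f k.
  exists (c p); rewrite hc -mulrA mulr_suml (@sum_words1 _ _ _ p) //.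
    by rewrite -scalerAl (mg_idem frY) -scalerAr mm_cons mulrA.
  by move=> q sq qp; rewrite -scalerAl (mg_orth frY) ?sp // (negPf qp) scaler0.
case: (pselect (exists2 k, k \in undup s & gc GX k (pe Y f) * (m p * g p) <> 0)).
  move=> [k ks kn]; exists k; have [c hc] := cE k ks.
  have hk : homog GX k (c *: (m (f :: p) * g p)).
    by rewrite -hc; apply: homog_eq (homogM (homog_gc GX k _) (homogX_mg p)) (addr0 k).
  have := @torsion_free _ _ _ _ frX c (gc GX k (m (f :: p) * g p) - m (f :: p) * g p) dom.
  rewrite scalerBr -gcZ hk subrr => /(_ erefl)[c0 |/eqP].
    by case: kn; rewrite hc c0 scale0r.
  by rewrite subr_eq0 => /eqP.
(* Here the whole element is zero, so any degree will do. *)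
move=> none; exists 0; rewrite fpE big_seq big1 ?homog0 // => [|k ks].
  exact: homog0.
by apply: contrapT => kn; apply: none; exists k.
Qed.
End TwoFamilies.

Lemma gc_homogl (R : comNzRingType) (L : algType R) (G : grading L) d k b a :
  homog G d b -> gc G (d + k) (b * a) = b * gc G k a.
Proof.
move=> hb; have [s hs] := gcS G a.
rewrite (hs _ (undup_uniq s)); last by move=> x; rewrite mem_undup.
rewrite mulr_sumr !gc_sum mulr_sumr; apply: eq_bigr => l _.
rewrite (gc_homog (d + k) (homogM hb (homog_gc G l a))) gc_gc (inj_eq (addrI d)).
by case: eqP; rewrite ?mulr0.
Qed.

Lemma gc_homogr (R : comNzRingType) (L : algType R) (G : grading L) d k b a :
  homog G d b -> gc G (k + d) (a * b) = gc G k a * b.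
Proof.
move=> hb; have [s hs] := gcS G a.
rewrite (hs _ (undup_uniq s)); last by move=> x; rewrite mem_undup.
rewrite mulr_suml !gc_sum mulr_suml; apply: eq_bigr => l _.
rewrite (gc_homog (k + d) (homogM (homog_gc G l a) hb)) gc_gc (inj_eq (addIr d)).
by case: eqP; rewrite ?mul0r.
Qed.

(** * Graded traces *)

Section Trace.
Variables (R : comNzRingType) (E : graph) (L : algType R) (X : LFamily E L).
Variable (fr : frame X).
Implicit Types (p q : seq (edge E)) (a b x y : L).
Let hf := fr_fam fr.
Notation m := (mm X). Notation g := (gg X). Notation vr := (vtx X).
Notation W := (words (edge E)).
Notation c0 := (deg0_coef fr).
Local Notation G := (fr_G fr).
Variables (V : lmodType {poly R}) (kap : seq (edge E) -> V).

(** Constant weights [kap] will count paths; weights in a presented module will give classes. *)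
Definition wtrace n x : V := \sum_(p <- W n) (c0 (g p * x * m p))%:P *: kap p.

Local Notation tr := wtrace.

Lemma trD n x y : tr n (x + y) = tr n x + tr n y.
Proof.
rewrite -big_split /=; apply: eq_bigr => p _.
by rewrite mulrDr mulrDl c0D polyCD scalerDl.
Qed.
Lemma trZ n c x : tr n (c *: x) = c%:P *: tr n x.
Proof.
rewrite scaler_sumr; apply: eq_bigr => p _.
by rewrite -scalerAr -scalerAl c0Z polyCM scalerA.
Qed.
Lemma tr0 n : tr n 0 = 0.
Proof. by rewrite -(scale0r 0) trZ polyC0 scale0r. Qed.

Lemma c0_gmm p q x : size p = size q -> c0 (g p * x * m q) = c0 (g p * gc G 0 x * m q).
Proof.
move=> s; rewrite /deg0_coef; congr (fr_chi fr _).
have := gc_homogr (- (size q)%:Z) (g p * x) (homog_m fr q); rewrite addNr => ->.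
have := gc_homogr (- (size q)%:Z) (g p * gc G 0 x) (homog_m fr q); rewrite addNr => ->.
have hp := homog_g fr p; rewrite -s -[- _]addr0 !(gc_homogl _ _ hp).
by rewrite gc_gc eqxx.
Qed.

(** One level further, each diagonal coefficient is repeated on the extensions of [p]; hence the
    trace is stable as soon as [kap p] is the sum of their weights. *)
Lemma coef_step n x p e : (0 < n)%N -> scal X n n (gc G 0 x) -> size p = n ->
  c0 (g (rcons p e) * x * m (rcons p e)) =
  if pth (rcons p e) then c0 (g p * x * m p) else 0.
Proof.
move=> n0 hs sp; rewrite (@c0_gmm (rcons p e)) // (@c0_gmm p) // gg_rcons mm_rcons.
have [c hc] := hs p p sp sp; rewrite hc.
have -> : pg X e * g p * gc G 0 x * (m p * pe X e) = c *: vr (rcons p e).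
  rewrite -!mulrA (mulrA _ (m p)) (mulrA (g p)) (mulrA (g p)) hc vtx_rconsE.
  by rewrite -scalerAl -scalerAr mulrA.
rewrite !c0_vtx -?size_eq0 ?size_rcons ?sp -?lt0n //.
case: ifP => // pe; suff -> : pth p by [].
by apply: contraT => /(not_pth_rcons e); rewrite pe.
Qed.

(** The coefficients agree with those of [trace_right]: the two orders of multiplication differ only
    in the level and in the weight, [kap (p ++ h)] against [kap (q ++ h)]. *)
Lemma trace_left p q k b : vr p = vr q -> tr (size p + k) (m p * g q * b) =
  \sum_(h <- W k) (c0 (g (q ++ h) * b * m (p ++ h)))%:P *: kap (p ++ h).
Proof.
move=> pq; rewrite /wtrace sum_wordsD (@sum_words1 _ _ _ p) //.
  apply: eq_bigr => h _; congr ((c0 _)%:P *: _); congr (_ * _); rewrite !gg_cat.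
  by rewrite -!mulrA (mulrA (g p)) -/(vr p) pq (mulrA _ (g q)) (vtx_gg hf).
move=> p' sp' np; rewrite big1 // => h _; rewrite gg_cat.
rewrite -!mulrA (mulrA (g p')) (gg_mm hf) // (negPf np) mul0r mulr0 c00.
by rewrite polyC0 scale0r.
Qed.

Lemma trace_right p q k b : vr p = vr q -> tr (size q + k) (b * (m p * g q)) =
  \sum_(h <- W k) (c0 (g (q ++ h) * b * m (p ++ h)))%:P *: kap (q ++ h).
Proof.
move=> pq; rewrite /wtrace sum_wordsD (@sum_words1 _ _ _ q) //.
  apply: eq_bigr => h _; congr ((c0 _)%:P *: _); rewrite !mm_cat -!mulrA.
  by rewrite (mulrA (g q) (m q)) -/(vr q) -pq (mulrA (m p)) (mm_vtx hf).
move=> q' sq' nq; rewrite big1 // => h _; rewrite mm_cat.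
rewrite !mulrA -(mulrA _ (g q)) (gg_mm hf) // eq_sym (negPf nq) mulr0 mul0r c00.
by rewrite polyC0 scale0r.
Qed.

Lemma same_tail_vtx p q h : h != [::] ->
  m (p ++ h) * g (q ++ h) = 0 \/ [/\ vr (p ++ h) = vr (q ++ h), pth (p ++ h) & pth (q ++ h)].
Proof.
case/lastP: h => // h e _; rewrite -!rcons_cat !(vtx_rcons hf).
case: (boolP (pth (rcons (p ++ h) e))) => [pp|/(mm_not_pth hf) ->]; last by left; rewrite mul0r.
case: (boolP (pth (rcons (q ++ h) e))) => [pq|/(gg_not_pth hf) ->]; last by left; rewrite mulr0.
by right.
Qed.

Variable (Gd : grading L).
Variable (m0 : nat).
Hypothesis m0_gt0 : (0 < m0)%N.
Hypothesis Gd_mg : forall p q h, size h = m0 -> exists d, homog Gd d (m (p ++ h) * g (q ++ h)).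

(** [Gd] may come from another family; extending both words of a monomial by a common tail of length
    [m0] yields monomials homogeneous for it. *)
Lemma homog_ind (P : L -> Prop) d : P 0 -> (forall x y, P x -> P y -> P (x + y)) ->
  (forall c x, P x -> P (c *: x)) ->
  (forall p q, vr p = vr q -> pth p -> pth q -> homog Gd d (m p * g q) ->
     (exists p' q' h, [/\ size h = m0, p = p' ++ h & q = q' ++ h]) -> P (m p * g q)) ->
  forall u, homog Gd d u -> P u.
Proof.
move=> P0 PD PZ Pm u <-.
elim/spanned_ind: {u}(fr_span fr u) => [|a b ha hb|c a ha|p q].
- by rewrite gc0.
- by rewrite gcD; apply: PD.
- by rewrite gcZ; apply: PZ.
rewrite (mg_words2 hf (fr_nosink fr) (fr_one fr) p q m0) gc_sum big_seq.
elim/big_rec: _ => // h x; rewrite mem_words => /eqP sh hx; apply: PD => //.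
have [d' hd'] := Gd_mg p q sh; rewrite (gc_homog d hd'); case: eqP => // dd'.
have h0 : h != [::] by rewrite -size_eq0 sh -lt0n.
have [-> // | [ev pp pq]] := same_tail_vtx p q h0.
by apply: Pm => //; [rewrite dd' | exists p, q, h].
Qed.

End Trace.

(** * Classes modulo a submodule [N], congruence being written [N (u - v)] *)

Section Class.
Variables (R : comNzRingType) (E : graph) (L : algType R) (X : LFamily E L).
Variable (fr : frame X).
Implicit Types (p q : seq (edge E)) (a b x y : L).
Let hf := fr_fam fr.
Notation m := (mm X). Notation g := (gg X). Notation vr := (vtx X).
Notation W := (words (edge E)).
Notation c0 := (deg0_coef fr).
Local Notation G := (fr_G fr).
Variables (V : lmodType {poly R}) (kap : seq (edge E) -> V) (N : V -> Prop).
Hypothesis N0 : N 0.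
Hypothesis ND : forall u v, N u -> N v -> N (u + v).
Hypothesis NZ : forall c u, N u -> N (c *: u).
Variables (Gd : grading L) (K : nat) (m0 : nat).
Hypothesis m0_gt0 : (0 < m0)%N.
Hypothesis kap_step : forall p, (m0 <= size p)%N -> pth p ->
  N (kap p - \sum_(e | pth (rcons p e)) kap (rcons p e)).
Hypothesis Gd_mg : forall p q h, size h = m0 -> exists d, homog Gd d (m (p ++ h) * g (q ++ h)).
Hypothesis Gd_diag : forall p, homog Gd 0 (m p * g p).
Hypothesis kap_tail : forall p q h d (a b : nat), size h = m0 ->
  pth (p ++ h) -> pth (q ++ h) -> homog Gd d (m (p ++ h) * g (q ++ h)) ->
  b%:Z - a%:Z = K%:Z * d -> 'X^a *: kap (p ++ h) = 'X^b *: kap (q ++ h).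
Notation tr := (wtrace fr kap).

Lemma NN u : N u -> N (- u). Proof. by rewrite -scaleN1r; exact: NZ. Qed.
Lemma NB u v : N u -> N v -> N (u - v).
Proof. by move=> hu /NN; exact: ND. Qed.
Lemma N_sym u v : N (u - v) -> N (v - u).
Proof. by move/NN; rewrite opprB. Qed.
Lemma N_trans v u w : N (u - v) -> N (v - w) -> N (u - w).
Proof. by move=> h1 h2; have := ND h1 h2; rewrite addrA subrK. Qed.
Lemma N_scale c u v : N (u - v) -> N (c *: u - c *: v).
Proof. by rewrite -scalerBr; exact: NZ. Qed.
Lemma N_add u v u' v' : N (u - v) -> N (u' - v') -> N ((u + u') - (v + v')).
Proof. by move=> h h'; rewrite opprD addrACA; exact: ND. Qed.
Lemma N_sum I (r : seq I) (P : pred I) (F : I -> V) :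
  (forall i, P i -> N (F i)) -> N (\sum_(i <- r | P i) F i).
Proof. by move=> h; elim/big_rec: _ => // i x Pi; apply: ND; exact: h. Qed.

Lemma tr_stable n n' x : (m0 <= n)%N -> (n <= n')%N -> scal X n n (gc G 0 x) ->
  N (tr n x - tr n' x).
Proof.
move=> mn /subnKC <- hs; elim: (n' - n)%N => [|k IHk]; first by rewrite addn0 subrr.
apply: N_trans IHk _; rewrite addnS; have hk := scalDn fr (n := k) hs.
rewrite /wtrace sum_wordsS -sumrB big_seq; apply: N_sum => p.
rewrite mem_words => /eqP sp.
have mk : (m0 <= n + k)%N by rewrite (leq_trans mn) ?leq_addr.
have k0 : (0 < n + k)%N by exact: leq_trans m0_gt0 mk.
under eq_bigr => e _ do rewrite (coef_step e k0 hk sp) (fun_if polyC) (fun_if (fun c => c *: _)) polyC0 scale0r.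
rewrite -big_mkcond -scaler_sumr -scalerBr.
case: (boolP (pth p)) => [pp|/(mm_not_pth hf) ->]; last first.
  by rewrite mulr0 c00 polyC0 scale0r.
by apply/NZ/kap_step; rewrite ?sp.
Qed.

Lemma tr_eventually x : exists n0, forall n n', (n0 <= n)%N -> (n0 <= n')%N ->
  N (tr n x - tr n' x).
Proof.
have [i [j [ij i0 j0 h]]] := homog_scal (homog_gc G 0 x).
have {}ij : i = j by lia.
rewrite ij in h i0; exists (m0 + j)%N => n n' hn hn'.
have hs k : (m0 + j <= k)%N -> scal X k k (gc G 0 x).
  move=> hk; have -> : k = (j + (k - j))%N by lia.
  exact: (scalDn fr).
have h0 := hs _ (leqnn _).
apply: (N_trans (v := tr (m0 + j) x)); last by apply: tr_stable; rewrite ?leq_addr.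
by apply/N_sym/tr_stable; rewrite ?leq_addr.
Qed.

(** The trace at a level from which on it is constant modulo [N]; the choice of level does not
    affect congruences. *)
Definition cls x : V := tr (projT1 (cid (tr_eventually x))) x.

Lemma clsP x : exists n0, forall n, (n0 <= n)%N -> N (tr n x - cls x).
Proof.
rewrite /cls; case: (cid _) => n0 /= h; exists n0 => n hn.
exact: h.
Qed.

Lemma cls0 : N (cls 0).
Proof. by rewrite /cls tr0. Qed.

Lemma clsD x y : N (cls (x + y) - (cls x + cls y)).
Proof.
have [n1 h1] := clsP x; have [n2 h2] := clsP y; have [n3 h3] := clsP (x + y).
pose n := (n1 + n2 + n3)%N.
apply: (N_trans (v := tr n (x + y))); first by apply/N_sym/h3; rewrite /n; lia.
rewrite trD opprD addrACA; apply: ND; [apply: h1 | apply: h2]; rewrite /n; lia.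
Qed.

Lemma clsZ c x : N (cls (c *: x) - c%:P *: cls x).
Proof.
have [n1 h1] := clsP x; have [n2 h2] := clsP (c *: x); pose n := (n1 + n2)%N.
apply: (N_trans (v := tr n (c *: x))); first by apply/N_sym/h2; rewrite /n; lia.
by rewrite trZ -scalerBr; apply/NZ/h1; rewrite /n; lia.
Qed.

Lemma cls_sum I (r : seq I) (P : pred I) (F : I -> L) :
  N (cls (\sum_(i <- r | P i) F i) - \sum_(i <- r | P i) cls (F i)).
Proof.
elim/big_rec2: _ => [|i y z Pi IH]; first by rewrite subr0; exact: cls0.
apply: (N_trans (v := cls (F i) + cls z)); first exact: clsD.
by rewrite opprD addrACA subrr add0r.
Qed.

Lemma cls_mg p : (m0 <= size p)%N -> pth p -> N (cls (m p * g p) - kap p).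
Proof.
move=> mp pp; have [n0 h0] := clsP (m p * g p).
apply: (N_trans (v := tr (n0 + size p) (m p * g p))).
  by apply/N_sym/h0; rewrite leq_addr.
have <- : tr (size p) (m p * g p) = kap p.
  have p0 : p != [::] by rewrite -size_eq0 -lt0n (leq_trans m0_gt0).
  rewrite /wtrace (@sum_words1 _ _ _ p) // => [|q sq qp].
    rewrite -mulrA (mm_gg_mm fr) -/(vr p) -[vr p]scale1r c0_vtx // pp.
    by rewrite scale1r.
  by rewrite mulrA (gg_mm hf) // (negPf qp) !mul0r c00 polyC0 scale0r.
apply/N_sym/tr_stable; rewrite ?leq_addl //.
by rewrite homog0_mg; apply: scal_mg => //; exact: leq_trans m0_gt0 mp.
Qed.

(** Two natural exponents replace [t^(K d)], since [d] may be negative. On monomials both sides have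
    the same coefficients, and [kap_tail] compares the weights. *)
Lemma cls_trace d (a b : nat) u x : homog Gd d u -> b%:Z - a%:Z = K%:Z * d ->
  N ('X^a *: cls (u * x) - 'X^b *: cls (x * u)).
Proof.
move=> hu ab; move: u hu; apply: (homog_ind (P := fun u => N ('X^a *: cls (u * x) - 'X^b *: cls (x * u))) fr m0_gt0 Gd_mg).
- by rewrite mul0r mulr0; apply: NB; apply: NZ; exact: cls0.
- move=> y z hy hz; rewrite mulrDl mulrDr.
  apply: N_trans (N_scale 'X^a (clsD _ _)) _; rewrite scalerDr.
  apply: N_trans (N_add hy hz) _; rewrite -scalerDr.
  exact/N_scale/N_sym/clsD.
- move=> c y hy; rewrite -scalerAl -scalerAr.
  apply: N_trans (N_scale 'X^a (clsZ _ _)) _; rewrite scalerA mulrC -scalerA.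
  apply: N_trans (N_scale c%:P hy) _; rewrite scalerA mulrC -scalerA.
  exact/N_scale/N_sym/clsZ.
move=> p q epq pp pq hd [p' [q' [h [sh pE qE]]]].
have [n1 h1] := clsP (m p * g q * x); have [n2 h2] := clsP (x * (m p * g q)).
pose k := (n1 + n2)%N.
apply: (N_trans (v := 'X^a *: tr (size p + k) (m p * g q * x))).
  by rewrite -scalerBr; apply/NZ/N_sym/h1; rewrite /k; lia.
apply: (N_trans (v := 'X^b *: tr (size q + k) (x * (m p * g q)))); last first.
  by rewrite -scalerBr; apply/NZ/h2; rewrite /k; lia.
suff -> : 'X^a *: tr (size p + k) (m p * g q * x) = 'X^b *: tr (size q + k) (x * (m p * g q)).
  by rewrite subrr.
rewrite trace_left // trace_right // !scaler_sumr; apply: eq_bigr => l _.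
rewrite !scalerA !(mulrC _ (_%:P)) -!scalerA.
case: (boolP (pth (p ++ l))) => [ppl|/(mm_not_pth hf) ->]; last first.
  by rewrite mulr0 c00 polyC0 !scale0r.
case: (boolP (pth (q ++ l))) => [pql|/(gg_not_pth hf) ->]; last first.
  by rewrite !mul0r c00 polyC0 !scale0r.
congr (_ *: _).
(* The last [m0] letters of [h ++ l] form a common tail of [p ++ l] and [q ++ l], even if [l] is
   short. *)
pose t := drop (size l) (h ++ l).
have st : size t = m0 by rewrite size_drop size_cat addnK.
have hl : h ++ l = take (size l) (h ++ l) ++ t by rewrite cat_take_drop.
have plE : p ++ l = (p' ++ take (size l) (h ++ l)) ++ t by rewrite pE -!catA -hl.
have qlE : q ++ l = (q' ++ take (size l) (h ++ l)) ++ t by rewrite qE -!catA -hl.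
rewrite plE qlE; apply: (kap_tail st) ab; rewrite -?plE -?qlE //.
have -> : m (p ++ l) * g (q ++ l) = (m p * g q) * (m (q ++ l) * g (q ++ l)).
  rewrite mulrA -(mulrA (m p)) (mm_cat _ q) (mulrA (g q)) -/(vr q) -epq.
  by rewrite mulrA (mm_vtx hf) mm_cat.
by apply: homog_eq (homogM hd (Gd_diag _)) _; rewrite addr0.
Qed.
End Class.

(** * Positivity of closed paths *)

Section Count.
Variables (R : comNzRingType) (E : graph) (L : algType R) (X : LFamily E L).
Hypothesis dom : forall a b : R, a * b = 0 -> a = 0 \/ b = 0.
Variable (fr : frame X).
Implicit Types (p q : seq (edge E)) (a b x y : L).
Let hf := fr_fam fr.
Notation m := (mm X). Notation g := (gg X). Notation vr := (vtx X).
Notation W := (words (edge E)).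
Notation c0 := (deg0_coef fr).
Local Notation G := (fr_G fr).

Definition count_tr n x : {poly R}^o := wtrace fr (fun=> 1 : {poly R}^o) n x.

Lemma count_trace d u x : homog G d u -> exists n0, forall n n',
  (n0 <= n)%N -> (n0 <= n')%N -> n%:Z - n'%:Z = d ->
  count_tr n (u * x) = count_tr n' (x * u).
Proof.
move=> hu; have hG p q h : size h = 1%N -> exists d, homog G d (m (p ++ h) * g (q ++ h)).
  by move=> _; exists ((size (p ++ h))%:Z - (size (q ++ h))%:Z); exact: fr_homog.
move: u hu; apply: (homog_ind (P := fun u => exists n0, forall n n',
  (n0 <= n)%N -> (n0 <= n')%N -> n%:Z - n'%:Z = d ->
  count_tr n (u * x) = count_tr n' (x * u)) fr (ltn0Sn 0) hG).
- by exists 0%N => n n' _ _ _; rewrite mul0r mulr0 /count_tr !tr0.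
- move=> y z [n1 h1] [n2 h2]; exists (n1 + n2)%N => n n' hn hn' nn'.
  rewrite mulrDl mulrDr /count_tr !trD -!/(count_tr _ _).
  by congr (_ + _); [apply: h1 | apply: h2] => //; lia.
- move=> c y [n1 h1]; exists n1 => n n' hn hn' nn'.
  by rewrite -scalerAl -scalerAr /count_tr !trZ -!/(count_tr _ _) (h1 n n').
move=> p q epq pp pq hd [p' [q' [h [sh pE qE]]]].
have q0 : q != [::] by rewrite -size_eq0 qE size_cat sh addn1.
have dE := homog_uniq hd (fr_homog fr p q) (mg_neq0 fr q0 pq epq).
exists (size p + size q)%N => n n' hn hn' nn'.
have -> : n = (size p + (n - size p))%N by lia.
have -> : n' = (size q + (n - size p))%N by lia.
by rewrite /count_tr trace_left // trace_right.
Qed.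

Definition cnt n x : nat := \sum_(p <- W n) (c0 (g p * x * m p)%R != 0%R).

Lemma diagonalE n x : (0 < n)%N -> diagonal X n x ->
  x = \sum_(p <- W n) c0 (g p * x * m p) *: (m p * g p).
Proof.
move=> n0 [c xE]; rewrite {1}xE; apply: eq_sum_words => p sp.
rewrite xE (diagonal_coef fr) // eqxx c0_vtx -?size_eq0 ?sp -?lt0n //.
by case: ifP => // /negbT/(mm_not_pth hf) ->; rewrite mul0r !scaler0.
Qed.

(** The entries of a diagonal idempotent are idempotent scalars, hence 0 or 1. *)
Lemma idem_coef n x p : (0 < n)%N -> diagonal X n x -> x * x = x -> size p = n ->
  c0 (g p * x * m p) = (c0 (g p * x * m p) != 0)%:R.
Proof.
move=> n0 hx xx sp; have p0 : p != [::] by rewrite -size_eq0 sp -lt0n.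
have [c hc] := diagonal_scal fr hx sp sp.
rewrite hc c0_vtx //; case: (boolP (pth p)) => [pp|_]; last by rewrite eqxx.
have cc : (c * c - c) *: vr p = 0.
  rewrite scalerBl -hc -{1}xx.
  have -> : g p * (x * x) * m p = \sum_(q <- W n) (g p * x * m q) * (g q * x * m p).
    rewrite -{1}(mulr1 x) (fr_words fr n) mulr_sumr mulr_suml mulr_sumr mulr_suml.
    by apply: eq_bigr => q _; rewrite !mulrA.
  rewrite (@sum_words1 _ _ _ p) // => [|q sq qp]; last first.
    by rewrite (diagonal_off fr hx) ?mul0r // eq_sym.
  by rewrite hc -scalerAl -scalerAr (vtx_vtx hf) scalerA subrr.
have := vtx_tf fr p0 pp cc; rewrite -{3}(mulr1 c) -mulrBr => /dom[->|/eqP].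
  by rewrite eqxx.
by rewrite subr_eq0 => /eqP ->; rewrite oner_eq0.
Qed.

Lemma count_tr_cnt n x : (0 < n)%N -> diagonal X n x -> x * x = x ->
  count_tr n x = (cnt n x)%:R.
Proof.
move=> n0 hx xx; rewrite /count_tr /wtrace /cnt natr_sum; apply: eq_sum_words => p sp.
rewrite [in LHS](idem_coef n0 hx xx sp); case: (_ == _) => /=; first by rewrite polyC0 scale0r.
by rewrite polyC1 scale1r.
Qed.

(** As there are no sinks, each path below [x] has an extension. *)
Lemma cntS n x : (0 < n)%N -> diagonal X n x -> (cnt n x <= cnt n.+1 x)%N.
Proof.
move=> n0 hx; rewrite /cnt /= big_allpairs_dep /= !big_seq; apply: leq_sum => p.
rewrite mem_words => /eqP sp; case: eqP => //= cn.
have pp : pth p.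
  by apply: contraT => /(mm_not_pth hf) h; case: cn; rewrite h mulr0 c00.
case/lastP: p => [|p e] in sp cn pp *; first by rewrite -sp in n0.
have [f fe] := fr_nosink fr (rng e).
have pf : pth (rcons (rcons p e) f) by rewrite /pth sorted_rcons2 -/(pth _) pp /succ_edge fe eqxx.
rewrite big_enum (bigD1 f) //= (coef_step f n0 _ sp) ?pf; last first.
  by rewrite (diagonal_homog fr hx); exact: diagonal_scal.
by case: eqP.
Qed.

Lemma cnt_le n k x : (0 < n)%N -> diagonal X n x -> (cnt n x <= cnt (n + k) x)%N.
Proof.
move=> n0 hx; elim: k => [|k IHk]; first by rewrite addn0.
apply: leq_trans IHk _; rewrite addnS; apply: cntS; first by lia.
exact: (diagonal_add fr).
Qed.

Lemma cnt_gt0 n x : (0 < n)%N -> diagonal X n x -> x != 0 -> (0 < cnt n x)%N.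
Proof.
move=> n0 hx; rewrite lt0n; apply: contra => /eqP c_eq0.
rewrite (diagonalE n0 hx) big_seq big1 // => p pw.
suff -> : c0 (g p * x * m p) = 0 by rewrite scale0r.
apply/eqP; move: c_eq0; rewrite /cnt (bigD1_seq p) ?uniq_words //= => /eqP.
by rewrite addn_eq0 eqb0 negbK => /andP[].
Qed.
End Count.

Section Positivity.
Variables (R : comNzRingType) (E F : graph) (L : algType R).
Variables (X : LFamily E L) (Y : LFamily F L) (conjR : R -> R) (st : L -> L).
Hypothesis dom : forall a b : R, a * b = 0 -> a = 0 \/ b = 0.
Hypothesis char0 : forall n, (n%:R : R) = 0 -> n = 0%N.
Hypothesis hstX : is_LPA_involution conjR X st.
Variables (frX : frame X) (frY : frame Y).
Hypothesis condLE : condition_L E.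
Hypothesis condLF : condition_L F.
Hypothesis hproj : forall p : L, is_projection st p -> in_diagonal Y p.
Notation m := (mm Y). Notation g := (gg Y). Notation vr := (vtx Y).
Local Notation GX := (fr_G frX).
Let hf := fr_fam frY.

Lemma polyR_inj : injective (fun n : nat => (n%:R : {poly R})).
Proof.
suff le n k : (n <= k)%N -> (n%:R : {poly R}) = k%:R -> n = k.
  move=> n k; case: (leqP n k) => [/le//|/ltnW /le h /esym/h ->//].
move=> nk /eqP; rewrite eq_sym -subr_eq0 -natrB // -polyC_natr polyC_eq0.
by move=> /eqP/char0; lia.
Qed.

(** If [k <= 0], then [cnt n q = cnt (n + |k|) p >= cnt n p = cnt n q + cnt n r], where [r = p - q]
    is an idempotent that Condition (L) makes nonzero. *)
Lemma closed_weight_pos (h d z : seq (edge F)) k : h != [::] -> d != [::] -> pth (h ++ d) ->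
  h ++ d = z ++ h -> homog GX k (m (h ++ d) * g h) -> 1 <= k.
Proof.
move=> h0 d0 phd hz hk; rewrite leNgt; apply/negP => kneg.
have [l [sl ld pl]] : exists l, [/\ size l = size d, l != d & pth (h ++ l)].
  case/lastP: h h0 phd hz {hk} => // h e _ phd hz.
  apply: (branching_pth (fr_nosink frY) condLF d0 phd).
  have := congr1 (last e) hz; rewrite !last_cat last_rcons => ->.
  by rewrite last_rcons.
set u := m (h ++ d) * g h in hk; pose v := m h * g (h ++ d).
pose p := m h * g h; pose q := m (h ++ d) * g (h ++ d); pose r := p - q.
have uv : u * v = q.
  rewrite /u /v /q mulrA -(mulrA _ (g h)) -/(vr h) hz (mm_cat _ z) -(mulrA (mm _ z)).
  by rewrite (mm_vtx hf).
have vu : v * u = p.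
  rewrite /u /v /p mulrA -(mulrA _ (g (h ++ d))) -/(vr (h ++ d)).
  suff -> : vr (h ++ d) = vr h by rewrite (mm_vtx hf).
  move: (phd); rewrite hz => /pth_cat2 ph; move: (phd); rewrite hz.
  case/lastP: h ph {u v p q r uv hk phd hz pl} h0 => // h e ph _.
  by rewrite -rcons_cat => pz; rewrite !(vtx_rcons hf) ph pz.
have pq : p * q = q by rewrite /p /q mm_cat !mulrA -(mulrA (m h)) (mm_vtx hf).
have qp : q * p = q by rewrite /p /q gg_cat -!mulrA (mulrA (g h)) (vtx_gg hf).
have pp : p * p = p := mg_idem frY h.
have qq : q * q = q := mg_idem frY _.
have rr : r * r = r by rewrite /r mulrBl !mulrBr pp pq qp qq subrr subr0.
have r0 : r != 0.
  have /eqP v0 : vr (h ++ l) != 0.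
    by apply: (vtx_neq0 frY) => //; rewrite -size_eq0 size_cat addn_eq0 size_eq0 negb_and h0.
  apply/eqP => r0; apply: v0.
  have : g (h ++ l) * r * m (h ++ l) = 0 by rewrite r0 mulr0 mul0r.
  have gq : g (h ++ l) * q = 0.
    rewrite /q mulrA (gg_mm hf) ?size_cat ?sl // eqseq_cat // eqxx /= (negPf ld).
    by rewrite mul0r.
  rewrite /r mulrBr gq subr0 => <-.
  by rewrite /vtx -mulrA mm_cat (mulrA p) (mm_gg_mm frY).
have [n1 hp] := diagonal_YX hstX frX frY condLE hproj (diagonal_mg Y h).
have [n2 hq] := diagonal_YX hstX frX frY condLE hproj (diagonal_mg Y (h ++ d)).
have [n0 hn0] := count_trace v hk.
(* [n] passes all thresholds; as [k <= 0], raising the level by [j] compensates the degree. *)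
pose n := (n0 + n1 + n2).+1; pose j := `|k|%N.
have npos : (0 < n)%N by [].
have Dp : diagonal X n p by apply: (diagonal_le frX _ hp); rewrite /n; lia.
have Dq : diagonal X n q by apply: (diagonal_le frX _ hq); rewrite /n; lia.
have Dr : diagonal X n r.
  by rewrite /r -scaleN1r; apply: diagonalD => //; exact: diagonalZ.
have := hn0 n (n + j)%N; rewrite uv vu (count_tr_cnt dom frX npos Dq qq).
rewrite (count_tr_cnt dom frX _ (diagonal_add frX j Dp) pp) ?addn_gt0 //.
move=> /(_ _ _ _)/polyR_inj qn.
have {}qn : cnt frX n q = cnt frX (n + j) p by apply: qn; rewrite /n /j; lia.
have : count_tr frX n p = count_tr frX n q + count_tr frX n r.
  by rewrite /count_tr -trD /r addrC subrK.
rewrite !count_tr_cnt // -natrD => /polyR_inj.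
have := cnt_le frX j npos Dp; have := cnt_gt0 frX npos Dr r0.
rewrite qn; lia.
Qed.
End Positivity.

Lemma exists_min (s : seq int) : s != [::] -> exists2 d, d \in s & forall x, x \in s -> d <= x.
Proof.
elim: s => // x s IHs _; case: (eqVneq s [::]) => [->|/IHs [d ds dm]].
  by exists x; rewrite ?mem_head // => y; rewrite inE => /eqP ->.
case: (leP x d) => xd.
  exists x; rewrite ?mem_head // => y; rewrite inE => /predU1P[->//|/dm].
  exact: le_trans.
exists d; rewrite ?inE ?ds ?orbT // => y; rewrite inE => /predU1P[->|/dm//].
exact: ltW.
Qed.

(** * Weights on a higher block graph *)

Section Potential.
Variables (V A : finType) (nx : V -> A -> V) (ok : V -> A -> bool) (w : V -> A -> int).

Fixpoint okwalk v l := if l is a :: l' then ok v a && okwalk (nx v a) l' else true.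
Fixpoint endwalk v l := if l is a :: l' then endwalk (nx v a) l' else v.
Fixpoint weight v l := if l is a :: l' then w v a + weight (nx v a) l' else 0.

Lemma okwalk_cat v l l' : okwalk v (l ++ l') = okwalk v l && okwalk (endwalk v l) l'.
Proof. by elim: l v => //= a l IHl v; rewrite IHl andbA. Qed.
Lemma endwalk_cat v l l' : endwalk v (l ++ l') = endwalk (endwalk v l) l'.
Proof. by elim: l v => //=. Qed.
Lemma weight_cat v l l' : weight v (l ++ l') = weight v l + weight (endwalk v l) l'.
Proof. by elim: l v => [|a l IHl] v /=; rewrite ?add0r // IHl addrA. Qed.

Hypothesis closed_pos : forall v l, l != [::] -> okwalk v l -> endwalk v l = v ->
  1 <= weight v l.

(** Shortest walks for the cost [K * w - 1] per letter: a nonempty closed walk of length at most [K]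
    has nonnegative cost, so cutting it out makes no walk more expensive. *)
Let K := #|V|.+1.
Let val v l : int := K%:Z * weight v l - (size l)%:Z.

Lemma shorten_walk v l : okwalk v l -> exists l', [/\ okwalk v l', (size l' <= K)%N &
  val v l' <= val v l].
Proof.
have [n] := ubnP (size l); elim: n l => // n IHn l ln okl.
case: (leqP (size l) K) => lK; first by exists l.
(* Pigeonhole: [K] prefixes, but only [K - 1] states. *)
have : ~~ injectiveb (fun i : 'I_K => endwalk v (take i l)).
  by apply/negP => /injectiveP/leq_card; rewrite card_ord ltnn.
case/injectivePn => i [j ij eij].
wlog lt_ij : i j ij eij / (i < j)%N.
  move=> H; case: (ltngtP i j) => [h|h|/val_inj h]; first exact: (H i j).
    by apply: (H j i) => //; rewrite eq_sym.
  by rewrite h eqxx in ij.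
pose l1 := take i l; pose l2 := drop i (take j l); pose l3 := drop j l.
have lE : l = l1 ++ l2 ++ l3.
  by rewrite catA /l1 /l2 -{1}(take_takel l (ltnW lt_ij)) cat_take_drop cat_take_drop.
have l12 : l1 ++ l2 = take j l.
  by rewrite /l1 -(take_takel l (ltnW lt_ij)) cat_take_drop.
have e2 : endwalk (endwalk v l1) l2 = endwalk v l1 by rewrite -endwalk_cat l12.
have s2 : size l2 = (j - i)%N.
  by rewrite size_drop size_takel // (leq_trans (ltnW (ltn_ord j)) (ltnW lK)).
move: okl; rewrite {1}lE !okwalk_cat e2 => /and3P[ok1 ok2 ok3].
have w2 : 1 <= weight (endwalk v l1) l2.
  by apply: closed_pos => //; rewrite -size_eq0 s2; lia.
have vE : val v (l1 ++ l3) <= val v l.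
  rewrite /val lE !weight_cat e2 !size_cat s2.
  have : (j - i)%:Z <= K%:Z * weight (endwalk v l1) l2.
    apply: (@le_trans _ _ K%:Z); first by have := ltn_ord j; lia.
    by rewrite ler_peMr.
  by rewrite !mulrDr; lia.
have sl : size l = (size l1 + size l2 + size l3)%N by rewrite lE !size_cat addnA.
have [||l' [ok' s' v']] := IHn (l1 ++ l3).
- rewrite size_cat; move: ln; rewrite ltnS => ln; lia.
- by rewrite okwalk_cat ok1.
by exists l'; split => //; apply: le_trans vE.
Qed.

(** [h v] is the least cost of a walk from [v], attained because walks of length at most [K]
    suffice; prefixing one letter to an optimal walk gives the inequality. *)
Lemma potential : exists h : V -> int, forall v a, ok v a ->
  1 <= K%:Z * w v a + h (nx v a) - h v.
Proof.
have hex v : exists d, (exists2 l, okwalk v l & val v l = d) /\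
    forall l, okwalk v l -> d <= val v l.
  pose s := [seq val v l | l <- [seq l <- flatten [seq words A n | n <- iota 0 K.+1] | okwalk v l]].
  have ins l : (size l <= K)%N -> okwalk v l -> val v l \in s.
    move=> lK okl; apply/map_f; rewrite mem_filter okl; apply/flattenP.
    exists (words A (size l)); last by rewrite mem_words.
    by apply/map_f; rewrite mem_iota /= add0n ltnS.
  have s0 : s != [::] by apply/eqP => h; have := ins [::] isT isT; rewrite h.
  have [d /mapP[l] ] := exists_min s0.
  rewrite mem_filter => /andP[okl _] -> dm; exists (val v l); split; first by exists l.
  move=> l' okl'; have [l'' [ok'' s'' v'']] := shorten_walk okl'.
  by apply: le_trans v''; apply/dm/ins.
have [h hP] := choice hex; exists h => v a okva.
have [_ dm] := hP v; have [[l okl <-] _] := hP (nx v a).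
have := dm (a :: l); rewrite /= okva okl => /(_ isT).
by rewrite /val /= mulrDr; lia.
Qed.
End Potential.

Definition suffix_of (T : Type) k (s : seq T) := drop (size s - k) s.

Lemma suffix_of_cat (T : Type) k (s t : seq T) : size t = k -> suffix_of k (s ++ t) = t.
Proof. by move=> st; rewrite /suffix_of size_cat st addnK drop_size_cat. Qed.
Lemma suffix_of_id (T : Type) k (s : seq T) : size s = k -> suffix_of k s = s.
Proof. by move=> ss; rewrite -[s]cat0s suffix_of_cat. Qed.
Lemma size_suffix_of (T : Type) k (s : seq T) : (k <= size s)%N -> size (suffix_of k s) = k.
Proof. by move=> ks; rewrite size_drop subKn. Qed.
Lemma suffix_ofE (T : Type) k (s : seq T) : (k <= size s)%N ->
  s = take (size s - k) s ++ suffix_of k s.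
Proof. by move=> _; rewrite cat_take_drop. Qed.
Lemma suffix_of_catr (T : Type) k (s t : seq T) : (k <= size t)%N ->
  suffix_of k (s ++ t) = suffix_of k t.
Proof.
by move=> kt; rewrite {1}(suffix_ofE kt) catA suffix_of_cat // size_suffix_of.
Qed.

(* [om] is the degree in [G], scaled by [K] and normalised by a potential that depends
   only on the last [m0] letters. *)
Record weight_system (R : comNzRingType) (E : graph) (L : algType R) (X : LFamily E L)
    (G : grading L) (K m0 : nat) (om : seq (edge E) -> nat) : Prop := WeightSystem {
  ws_gt0 : (0 < m0)%N;
  ws_local : forall p e, (m0 <= size p)%N -> pth (rcons p e) ->
    (om (rcons p e) + om (suffix_of m0 p) = om p + om (rcons (suffix_of m0 p) e))%N;
  ws_incr : forall p e, (m0 <= size p)%N -> pth (rcons p e) -> (om p < om (rcons p e))%N;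
  ws_homog : forall p q h, size h = m0 -> pth (p ++ h) -> pth (q ++ h) ->
    exists2 d, homog G d (mm X (p ++ h) * gg X (q ++ h)) &
      K%:Z * d = (om (p ++ h))%:Z - (om (q ++ h))%:Z;
  ws_diag : forall p, homog G 0 (mm X p * gg X p) }.

(** In its own grading every edge has degree 1 whatever follows, so the least positive block length
    will do; [K] matches the scale of the other family. *)
Lemma own_weight_system (R : comNzRingType) (E : graph) (L : algType R) (X : LFamily E L)
  (fr : frame X) K : (0 < K)%N ->
  weight_system X (fr_G fr) K 1 (fun p => (K * size p)%N).
Proof.
move=> K0; split=> //.
- by move=> p e p1 _; rewrite !size_rcons size_suffix_of // ; lia.
- by move=> p e _ _; rewrite size_rcons ltn_pmul2l.
- move=> p q h _ _ _; exists ((size (p ++ h))%:Z - (size (q ++ h))%:Z); last by lia.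
  exact: fr_homog.
- by move=> p; exact: homog0_mg.
Qed.

(** * Weights of one family in the grading of the other *)

Section CrossWeights.
Variables (R : comNzRingType) (E F : graph) (L : algType R).
Variables (X : LFamily E L) (Y : LFamily F L) (conjR : R -> R) (st : L -> L).
Hypothesis dom : forall a b : R, a * b = 0 -> a = 0 \/ b = 0.
Hypothesis char0 : forall n, (n%:R : R) = 0 -> n = 0%N.
Hypothesis hstX : is_LPA_involution conjR X st.
Hypothesis hstY : is_LPA_involution conjR Y st.
Variables (frX : frame X) (frY : frame Y).
Hypothesis condLE : condition_L E.
Hypothesis condLF : condition_L F.
Hypothesis hproj : forall p : L, is_projection st p -> in_diagonal Y p.
Notation m := (mm Y). Notation g := (gg Y). Notation vr := (vtx Y).
Local Notation G := (fr_G frX).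
Let hf := fr_fam frY.
Implicit Types (x y z p q : seq (edge F)).

Let diagG p : homog G 0 (m p * g p) := homogX_mg hstX frX frY condLE hproj p.

Variable M : nat.
Hypothesis hM : forall (f : edge F) p, size p = M.+1 -> exists d, homog G d (m (f :: p) * g p).
Notation m0 := M.+1.
Notation sf := (suffix_of m0).

Lemma mg_split x y z : size y = m0 ->
  m (x ++ y ++ z) * g (sf (x ++ y ++ z)) =
  (m (x ++ y) * g (sf (x ++ y))) * (m (y ++ z) * g (sf (y ++ z))).
Proof.
move=> sy; rewrite (@suffix_of_cat _ _ x y) // (@suffix_of_catr _ _ x (y ++ z)); last first.
  by rewrite size_cat sy leq_addr.
rewrite mulrA -(mulrA _ (g y)) (mm_cat _ y z) (mulrA (g y)) -/(vr y) mulrA.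
by rewrite (mm_cat _ x y) -(mulrA (m x)) (mm_vtx hf) -!mm_cat catA.
Qed.

Lemma wdeg_exists p : (m0 <= size p)%N -> exists d, homog G d (m p * g (sf p)).
Proof.
elim: p => // f p IHp; rewrite leq_eqVlt => /predU1P[/esym sp|].
  by exists 0; rewrite suffix_of_id.
rewrite ltnS => sp; have [d hd] := IHp sp.
have st0 : size (take m0 p) = m0 by rewrite size_takel.
have [d' hd'] := hM f st0; exists (d' + d).
have := mg_split [:: f] (drop m0 p) st0; rewrite cat_take_drop => ->.
by apply: homogM => //; rewrite suffix_of_cat.
Qed.

(** Degree of a path relative to its last [m0] letters; the path itself need not be homogeneous. *)
Definition wdeg p : int := if pselect (exists d, homog G d (m p * g (sf p))) is left h
  then projT1 (cid h) else 0.

Lemma wdegP p : (m0 <= size p)%N -> homog G (wdeg p) (m p * g (sf p)).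
Proof.
move=> /wdeg_exists h; rewrite /wdeg; case: pselect => // h'.
by case: (cid h').
Qed.

Lemma mg_sf_neq0 p : (m0 <= size p)%N -> pth p -> m p * g (sf p) != 0.
Proof.
move=> sp pp; have pE := suffix_ofE sp; set t := sf p in pE *.
have st0 : size t = m0 := size_suffix_of sp.
have pt : pth t by move: pp; rewrite pE => /pth_cat2.
apply: (mg_neq0 frY) => //; first by rewrite -size_eq0 st0.
rewrite pE in pp *; case/lastP: t pt pp {pE} st0 => // t e pt; rewrite -rcons_cat => pp _.
by rewrite !(vtx_rcons hf) pp pt.
Qed.

(** Cocycle identity over an overlap of [m0] letters: it makes [wdeg] a sum of one-letter steps
    depending only on the current block. *)
Lemma wdeg_split x y z : size y = m0 -> pth (x ++ y ++ z) ->
  wdeg (x ++ y ++ z) = wdeg (x ++ y) + wdeg (y ++ z).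
Proof.
move=> sy pxyz; have s k : (m0 <= k + (m0 + size z))%N by lia.
apply: (homog_uniq (G := G) _ _ (mg_sf_neq0 _ pxyz)).
- by apply: wdegP; rewrite !size_cat sy.
- by rewrite mg_split //; apply: homogM; apply: wdegP; rewrite size_cat sy; lia.
- by rewrite !size_cat sy.
Qed.

Lemma wdeg_base y : size y = m0 -> pth y -> wdeg y = 0.
Proof.
move=> sy py; apply: (homog_uniq (G := G) _ _ (mg_sf_neq0 _ py)); rewrite ?sy //.
  by apply: wdegP; rewrite sy.
by rewrite suffix_of_id.
Qed.

Lemma wdeg_rcons p e : (m0 <= size p)%N -> pth (rcons p e) ->
  wdeg (rcons p e) = wdeg p + wdeg (rcons (sf p) e).
Proof.
move=> sp; rewrite {1 2 3}(suffix_ofE sp) -!cats1 -catA => pp.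
by apply: wdeg_split => //; exact: size_suffix_of.
Qed.

Local Notation V := (m0.-tuple (edge F)).
Definition shift (t : V) (e : edge F) : V := [tuple of behead (rcons t e)].
Definition ok (t : V) (e : edge F) := pth (rcons t e).
Definition wstep (t : V) (e : edge F) := wdeg (rcons t e).

Lemma shiftE (t : V) e : exists f : edge F, rcons t e = f :: shift t e.
Proof.
case: t => -[|x s] //= hs; exists x; rewrite /shift /=.
by congr cons.
Qed.

Lemma pth_overlap x y z : y != [::] -> pth (x ++ y) -> pth (y ++ z) -> pth (x ++ y ++ z).
Proof.
case: y => // a y _; case: x => [|b x] //=; rewrite !cat_path /= !cat_path.
by case/and3P=> -> -> -> ->.
Qed.

(** Identifies the weight of a walk on blocks with a degree, so that positivity of closed paths
    becomes the hypothesis of [potential]. *)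
Lemma walk_word (t : V) l : pth t -> okwalk shift ok t l -> [/\ pth (t ++ l),
  (endwalk shift t l : seq _) = sf (t ++ l) & weight shift wstep t l = wdeg (t ++ l)].
Proof.
elim: l t => [|e l IHl] t pt /=.
  by rewrite cats0 suffix_of_id ?size_tuple // wdeg_base ?size_tuple.
case/andP=> okte okl; have [x tE] := shiftE t e.
have su : size (shift t e) = m0 by rewrite size_tuple.
have pe_ : pth (x :: shift t e) by rewrite -tE.
have pu : pth (shift t e) by move: pe_; rewrite -cat1s => /pth_cat2.
have [pl el wl] := IHl _ pu okl.
have -> : t ++ e :: l = [:: x] ++ shift t e ++ l by rewrite -cat_rcons tE.
have pp : pth ([:: x] ++ shift t e ++ l).
  by apply: pth_overlap => //; rewrite -size_eq0 su.
split=> //.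
  by rewrite el [RHS]suffix_of_catr // size_cat su leq_addr.
by rewrite wl wdeg_split // /wstep tE.
Qed.

Lemma closed_walk_pos (t : V) l : l != [::] -> okwalk shift ok t l -> endwalk shift t l = t ->
  1 <= weight shift wstep t l.
Proof.
move=> l0 okl etl.
have pt : pth t.
  case: l l0 okl {etl} => // e l _ /= /andP[+ _]; rewrite /ok -cats1.
  exact: pth_cat1.
have [pl el ->] := walk_word pt okl; rewrite etl in el.
have ml : (m0 <= size (t ++ l))%N by rewrite size_cat size_tuple leq_addr.
have := @closed_weight_pos _ _ _ _ _ _ _ _ dom char0 hstX frX frY condLE condLF hproj
  t l (take (size (t ++ l) - m0) (t ++ l)) (wdeg (t ++ l)).
apply=> //.
- by rewrite -size_eq0 size_tuple.
- by rewrite {1}(suffix_ofE ml) -el.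
- by rewrite [in g _]el; exact: wdegP.
Qed.

Lemma cross_weight_system : exists K om, (0 < K)%N /\ weight_system Y G K m0 om.
Proof.
have [h hh] := potential closed_walk_pos.
set K := #|{: V}|.+1 in hh.
pose hs (p : seq (edge F)) : int := if insub p is Some t then h t else 0.
have hsE (t : V) : hs t = h t by rewrite /hs valK.
(* [C] bounds every [|h t|] and makes [omz] nonnegative on single blocks; on longer paths it follows
   because [omz] increases. *)
pose C : int := \sum_(t : V) `|h t|.
have hC p : 0 <= hs p + C.
  rewrite /hs; case: insubP => [t _ _|_]; last by rewrite add0r sumr_ge0.
  rewrite /C (bigD1 t) //= addrA addr_ge0 ?sumr_ge0 //.
  by have := ler_norm (- h t); rewrite normrN; lia.
pose omz p : int := K%:Z * wdeg p + hs (sf p) + C.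
have omz_step p e : (m0 <= size p)%N -> pth (rcons p e) ->
    omz (rcons p e) = omz p + (omz (rcons (sf p) e) - omz (sf p)) /\ omz p < omz (rcons p e).
  move=> sp pp; have ss : size (sf p) = m0 := size_suffix_of sp.
  have sse : sf (rcons p e) = sf (rcons (sf p) e).
    rewrite {1}(suffix_ofE sp) -!cats1 -catA suffix_of_catr //.
    by rewrite size_cat ss addn1.
  have pse : pth (rcons (sf p) e).
    by move: pp; rewrite {1}(suffix_ofE sp) -cats1 -catA => /pth_cat2; rewrite cats1.
  have ps : pth (sf p) by move: pse; rewrite -cats1 => /pth_cat1.
  have d0 : wdeg (sf p) = 0 by exact: wdeg_base.
  rewrite /omz sse wdeg_rcons // (suffix_of_id ss) d0 mulr0 add0r mulrDr.
  split; first by lia.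
  pose t : V := tcast ss (in_tuple (sf p)).
  have tE : (t : seq _) = sf p by rewrite val_tcast.
  have := hh t e; rewrite /ok tE => /(_ pse); rewrite /wstep tE -!hsE tE.
  suff -> : (shift t e : seq _) = sf (rcons (sf p) e) by lia.
  have [x] := shiftE t e; rewrite tE => ->.
  by rewrite -cat1s suffix_of_cat // size_tuple.
have omz_ge0 p : (m0 <= size p)%N -> pth p -> 0 <= omz p.
  elim/last_ind: p => // p e IHp; rewrite size_rcons leq_eqVlt => /predU1P[sp|].
    move=> pp; rewrite /omz wdeg_base ?size_rcons -?sp // mulr0 add0r; exact: hC.
  rewrite ltnS => sp pp; have [_ h1] := omz_step p e sp pp.
  apply: le_trans (ltW h1); apply: IHp => //.
  by move: pp; rewrite -cats1 => /pth_cat1.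
have pth_l p e : pth (rcons p e) -> pth p by rewrite -cats1 => /pth_cat1.
exists K, (fun p => `|omz p|%N); split=> //; split=> //.
- move=> p e sp pp; have [h1 _] := omz_step p e sp pp.
  have ss : size (sf p) = m0 := size_suffix_of sp.
  have pse : pth (rcons (sf p) e).
    by move: pp; rewrite {1}(suffix_ofE sp) -cats1 -catA => /pth_cat2; rewrite cats1.
  have := omz_ge0 p sp (pth_l _ _ pp).
  have := omz_ge0 (rcons p e) _ pp; rewrite size_rcons => /(_ (leqW sp)).
  have := omz_ge0 _ _ (pth_l _ _ pse); rewrite ss => /(_ (leqnn _)).
  have := omz_ge0 _ _ pse; rewrite size_rcons ss => /(_ (leqnSn _)).
  by lia.
- move=> p e sp pp; have [_ h1] := omz_step p e sp pp.
  have := omz_ge0 p sp (pth_l _ _ pp).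
  by lia.
(* Both words end in [t], so the potential and [C] cancel in the difference. *)
- move=> p q t st_ pp pq; exists (wdeg (p ++ t) - wdeg (q ++ t)).
    have sp : (m0 <= size (p ++ t))%N by rewrite size_cat st_ leq_addl.
    have sq : (m0 <= size (q ++ t))%N by rewrite size_cat st_ leq_addl.
    have -> : m (p ++ t) * g (q ++ t) = (m (p ++ t) * g t) * (m t * g (q ++ t)).
      rewrite [RHS]mulrA -(mulrA _ (g t)) -/(vr t) [in RHS](mm_cat _ p) -(mulrA (m p) (m t)).
      by rewrite (mm_vtx hf) -mm_cat.
    have h1 := wdegP sp; have h2 := homog_st hstX (wdegP sq).
    rewrite (st_mg hstY) in h2; rewrite !suffix_of_cat // in h1 h2.
    exact: homogM.
  have := omz_ge0 (p ++ t) _ pp; have := omz_ge0 (q ++ t) _ pq.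
  rewrite !size_cat st_ !leq_addl => /(_ isT) h1 /(_ isT) h2.
  rewrite !gez0_abs // /omz !suffix_of_cat //; lia.
Qed.
End CrossWeights.

(** * Comparison of the presentation matrices *)

Section BlockMatrix.
Variables (R : comNzRingType) (E : graph) (m0 : nat) (om : seq (edge E) -> nat).
Local Notation T := (m0.-tuple (edge E)).
Local Notation n := (#|{: T}|).

Definition bgen (s : seq (edge E)) : 'rV[{poly R}]_n :=
  \row_(i < n) (val (enum_val i : T) == s)%:R.
Definition bstep (t : seq (edge E)) e : nat := (om (rcons t e) - om t)%N.
(* The relation expressing the class of [t] through those of its one-letter
   extensions. Words that are not paths are kept as generators: their relation is
   the generator itself, which does not change the determinant. *)
Definition brow (t : seq (edge E)) : 'rV[{poly R}]_n :=
  bgen t - \sum_(e | pth (rcons t e)) 'X^(bstep t e) *: bgen (behead (rcons t e)).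
Definition bmat : 'M[{poly R}]_n := \matrix_(i < n) brow (val (enum_val i : T)).

Lemma bgenE (t : T) : bgen t = delta_mx 0 (enum_rank t).
Proof.
apply/rowP => i; rewrite !mxE eqxx /= val_eqE.
by rewrite -[t in LHS]enum_rankK (inj_eq enum_val_inj).
Qed.

Lemma bgen_mul (t : T) k (A : 'M_(n, k)) : bgen t *m A = row (enum_rank t) A.
Proof. by rewrite bgenE -rowE. Qed.

Lemma brow_mat (t : T) : brow t = bgen t *m bmat.
Proof. by rewrite bgen_mul rowK enum_rankK. Qed.

(* Saturating by the powers of ['X] replaces working over Laurent polynomials. *)
Definition bnull (x : 'rV[{poly R}]_n) := exists a z, 'X^a *: x = z *m bmat.

Lemma bnull0 : bnull 0.
Proof. by exists 0%N, 0; rewrite scaler0 mul0mx. Qed.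
Lemma bnullD x y : bnull x -> bnull y -> bnull (x + y).
Proof.
move=> [a [z hz]] [b [z' hz']]; exists (a + b)%N, ('X^b *: z + 'X^a *: z').
rewrite mulmxDl -!scalemxAl -hz -hz' scalerDr !scalerA -!exprD.
by rewrite (addnC b a).
Qed.
Lemma bnullZ c x : bnull x -> bnull (c *: x).
Proof.
by move=> [a [z hz]]; exists a, (c *: z); rewrite -scalemxAl -hz !scalerA mulrC.
Qed.
Lemma bnull_sat b x : bnull ('X^b *: x) -> bnull x.
Proof. by move=> [a [z hz]]; exists (a + b)%N, z; rewrite exprD -scalerA. Qed.
Lemma bnull_brow (t : T) : bnull (brow t).
Proof. by exists 0%N, (bgen t); rewrite expr0 scale1r brow_mat. Qed.

(** The value given to the class of [p p^*]. The generator of a block [t] thus stands for the class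
    of [t t^*] divided by ['X^(om t)]. *)
Definition bkap (p : seq (edge E)) : 'rV[{poly R}]_n :=
  'X^(om p) *: bgen (suffix_of m0 p).
End BlockMatrix.

Section System.
Variables (R : comNzRingType) (E : graph) (L : algType R) (X : LFamily E L).
Variables (fr : frame X) (G : grading L) (K m0 : nat) (om : seq (edge E) -> nat).
Hypothesis ws : weight_system X G K m0 om.
Notation m := (mm X). Notation g := (gg X).
Let hf := fr_fam fr.
Let m0_gt0 := ws_gt0 ws.
Local Notation kap := (bkap R m0 om).
Local Notation N := (@bnull R E m0 om).
Local Notation sf := (suffix_of m0).
Implicit Types (p q h : seq (edge E)) (u x : L).

Lemma pth_rcons_cat (x t : seq (edge E)) e : t != [::] -> pth (x ++ t) ->
  pth (rcons (x ++ t) e) = pth (rcons t e).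
Proof.
case/lastP: t => // t f _; rewrite -rcons_cat => pp.
rewrite /pth !sorted_rcons2 -!/(pth _) pp.
by move: pp; rewrite rcons_cat => /pth_cat2 ->.
Qed.

Lemma pth_rcons_suffix p e : (m0 <= size p)%N -> pth p ->
  pth (rcons p e) = pth (rcons (sf p) e).
Proof.
move=> sp pp; have := @pth_rcons_cat (take (size p - m0) p) (sf p) e.
rewrite -suffix_ofE // -size_eq0 size_suffix_of // -lt0n; exact.
Qed.

Lemma suffix_of_rcons (T : Type) k (p : seq T) (e : T) : (k <= size p)%N ->
  suffix_of k (rcons p e) = behead (rcons (suffix_of k p) e).
Proof.
move=> kp; rewrite {1}(suffix_ofE kp) -cats1 -catA cats1.
have ss := size_suffix_of kp; rewrite suffix_of_catr ?size_rcons ?ss //.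
by rewrite /suffix_of size_rcons ss subSnn drop1.
Qed.

Definition seq_tuple (p : seq (edge E)) (h : size p = m0) : m0.-tuple (edge E) :=
  tcast h (in_tuple p).
Lemma seq_tupleE p (h : size p = m0) : (seq_tuple h : seq _) = p.
Proof. by rewrite val_tcast. Qed.

(** By [ws_local] the increments of [om] depend only on the last block, so the relation at [p] is a
    multiple of the row of its suffix. *)
Lemma kap_step p : (m0 <= size p)%N -> pth p ->
  N (kap p - \sum_(e | pth (rcons p e)) kap (rcons p e)).
Proof.
move=> sp pp; have ss := size_suffix_of sp.
suff -> : kap p - \sum_(e | pth (rcons p e)) kap (rcons p e) = 'X^(om p) *: brow R m0 om (sf p).
  by apply: bnullZ; rewrite -(seq_tupleE ss); exact: bnull_brow.
rewrite scalerBr scaler_sumr; congr (_ - _).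
apply: eq_big => [e|e pe]; first exact: pth_rcons_suffix.
rewrite /bkap suffix_of_rcons // scalerA -exprD; congr ('X^_ *: _).
have := ws_local ws sp pe; have := ws_incr ws (p := sf p) (e := e).
rewrite ss leqnn -pth_rcons_suffix // => /(_ isT pe).
by rewrite /bstep; lia.
Qed.

Lemma ws_mg p q h : size h = m0 -> exists d, homog G d (m (p ++ h) * g (q ++ h)).
Proof.
move=> sh; case: (boolP (pth (p ++ h))) => [pp|/(mm_not_pth hf) ->]; last first.
  by exists 0; rewrite mul0r; exact: homog0.
case: (boolP (pth (q ++ h))) => [pq|/(gg_not_pth hf) ->]; last first.
  by exists 0; rewrite mulr0; exact: homog0.
by have [d hd _] := ws_homog ws sh pp pq; exists d.
Qed.

Lemma mg_tail_neq0 p q h : h != [::] -> pth (p ++ h) -> pth (q ++ h) ->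
  m (p ++ h) * g (q ++ h) != 0.
Proof.
move=> h0 pp pq; apply: (mg_neq0 fr) => //.
  by rewrite -size_eq0 size_cat addn_eq0 negb_and !size_eq0 h0 orbT.
by case/lastP: h h0 pp pq => // h e _; rewrite -!rcons_cat !(vtx_rcons hf) => -> ->.
Qed.

Lemma kap_tail p q h d (a b : nat) : size h = m0 ->
  pth (p ++ h) -> pth (q ++ h) -> homog G d (m (p ++ h) * g (q ++ h)) ->
  b%:Z - a%:Z = K%:Z * d -> 'X^a *: kap (p ++ h) = 'X^b *: kap (q ++ h).
Proof.
move=> sh pp pq hd ab; have [d' hd' Kd] := ws_homog ws sh pp pq.
have h0 : h != [::] by rewrite -size_eq0 sh -lt0n.
have dd := homog_uniq hd hd' (mg_tail_neq0 h0 pp pq).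
rewrite /bkap !suffix_of_cat // !scalerA -!exprD; congr ('X^_ *: _).
by move: ab; rewrite dd Kd; lia.
Qed.

Definition bcls : L -> 'rV[{poly R}]_(#|{: m0.-tuple (edge E)}|) :=
  cls fr (@bnull0 _ _ _ _) (@bnullD _ _ _ _) (@bnullZ _ _ _ _) m0_gt0 kap_step.

Lemma bcls_sum I (r : seq I) (P : pred I) (F : I -> L) :
  N (bcls (\sum_(i <- r | P i) F i) - \sum_(i <- r | P i) bcls (F i)).
Proof. exact: cls_sum. Qed.
Lemma bclsZ c x : N (bcls (c *: x) - c%:P *: bcls x).
Proof. exact: clsZ. Qed.
Lemma bcls0 : N (bcls 0). Proof. exact: cls0. Qed.
Lemma bcls_mg p : (m0 <= size p)%N -> pth p -> N (bcls (m p * g p) - kap p).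
Proof. exact: cls_mg. Qed.
Lemma bcls_trace d (a b : nat) u x : homog G d u -> b%:Z - a%:Z = K%:Z * d ->
  N ('X^a *: bcls (u * x) - 'X^b *: bcls (x * u)).
Proof. exact: (cls_trace _ _ _ _ _ _ ws_mg (ws_diag ws) kap_tail). Qed.
End System.

(** [P] and [Q] present two modules; the first equation makes [A] a map between them, the second
    makes it surjective up to [T]. *)
Lemma det_fitting (S : comNzRingType) n k (P : 'M[S]_n) (Q : 'M[S]_k) (A : 'M_(n, k))
    (B : 'M_(k, n)) (C : 'M_(n, k)) (D T : 'M_k) :
  P *m A = C *m Q -> B *m A - T = D *m Q -> exists w, \det P * \det T = w * \det Q.
Proof.
move=> h1 h2; exists (\det (block_mx P C (- B) (- D))).
have e : block_mx P 0 (- B) T = block_mx P C (- B) (- D) *m block_mx 1%:M (- A) 0 Q.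
  rewrite mulmx_block !mulmx1 !mulmx0 !addr0 mulmxN mulNmx mulmxN opprK mulNmx.
  by rewrite h1 addNr -h2 opprB addrC subrK.
by have := congr1 determinant e; rewrite det_lblock det_mulmx det_ublock det1 mul1r.
Qed.

(** * Divisibility between the two weighted determinants *)

Section Core.
Variables (R : comNzRingType) (L : algType R) (G : grading L) (K : nat).
Variables (E1 E2 : graph) (X1 : LFamily E1 L) (X2 : LFamily E2 L).
Variables (fr1 : frame X1) (fr2 : frame X2) (m1 m2 : nat).
Variables (om1 : seq (edge E1) -> nat) (om2 : seq (edge E2) -> nat).
Hypothesis ws1 : weight_system X1 G K m1 om1.
Hypothesis ws2 : weight_system X2 G K m2 om2.
Hypothesis diag12 : forall p, exists n, diagonal X2 n (mm X1 p * gg X1 p).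
Local Notation T1 := (m1.-tuple (edge E1)).
Local Notation T2 := (m2.-tuple (edge E2)).
Local Notation N := (@bnull R E1 m1 om1).
Local Notation cl := (bcls fr1 ws1).
Local Notation Q1 := (bmat R m1 om1).
Local Notation Q2 := (bmat R m2 om2).
Local Notation mg p := (mm X2 p * gg X2 p).
Let hf := fr_fam fr2.
Let m2_gt0 := ws_gt0 ws2.

Let N0 : N 0 := @bnull0 _ _ _ _.
Let ND := @bnullD R E1 m1 om1.
Let NZ := @bnullZ R E1 m1 om1.
Let Ntr v u w : N (u - v) -> N (v - w) -> N (u - w).
Proof. exact: (N_trans ND). Qed.
Let Nsym u v : N (u - v) -> N (v - u).
Proof. exact: (N_sym NZ). Qed.
Let Nsc c u v : N (u - v) -> N (c *: u - c *: v).
Proof. exact: (N_scale NZ). Qed.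
Let Nsum I (r : seq I) (P : pred I) (F F' : I -> 'rV_#|{: T1}|) :
  (forall i, P i -> N (F i - F' i)) ->
  N (\sum_(i <- r | P i) F i - \sum_(i <- r | P i) F' i).
Proof. by rewrite -sumrB; exact: (N_sum N0 ND). Qed.

(** The trace property for [u = p t^*] and [x = t p^*], where [t] is the last block of [p]. *)
Lemma cl_suffix (p : seq (edge E2)) : (m2 <= size p)%N -> pth p ->
  N ('X^(om2 (suffix_of m2 p)) *: cl (mg p) -
     'X^(om2 p) *: cl (mg (suffix_of m2 p))).
Proof.
move=> sp pp; have ss := size_suffix_of sp; set t := suffix_of m2 p in ss *.
have pE : p = take (size p - m2) p ++ t := suffix_ofE sp.
have pt : pth t by move: (pp); rewrite pE => /pth_cat2.
have [|d hd Kd] := ws_homog ws2 (p := take (size p - m2) p) (q := [::]) ss _ pt.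
  by rewrite -pE.
rewrite -pE /= in hd Kd.
have t0 : t != [::] by rewrite -size_eq0 ss -lt0n.
have vE : vtx X2 p = vtx X2 t.
  move: pt pp; rewrite pE; case/lastP: (t) t0 => // s e _ ps.
  by rewrite -rcons_cat !(vtx_rcons hf) ps => ->.
have := bcls_trace fr1 ws1 (a := om2 t) (b := om2 p) (mm X2 t * gg X2 p) hd.
have -> : mm X2 p * gg X2 t * (mm X2 t * gg X2 p) = mg p.
  by rewrite mulrA -(mulrA _ (gg X2 t)) -/(vtx X2 t) -vE (mm_vtx hf).
have -> : mm X2 t * gg X2 p * (mm X2 p * gg X2 t) = mg t.
  by rewrite mulrA -(mulrA _ (gg X2 p)) -/(vtx X2 p) vE (mm_vtx hf).
by apply; rewrite -Kd.
Qed.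

(** The natural image of the generator of [t] is the class of [t t^*] divided by ['X^(om2 t)]; the
    factor ['X^C] clears this denominator in [phi]. *)
Let C : nat := (\sum_(t : T2) om2 t)%N.
Lemma om_le_C (t : T2) : (om2 t <= C)%N.
Proof. by rewrite /C (bigD1 t) //= leq_addr. Qed.
Lemma om_le_Cs t : size t = m2 -> (om2 t <= C)%N.
Proof. by move=> st; rewrite -(seq_tupleE st) om_le_C. Qed.

Definition phi : 'M[{poly R}]_(#|{: T2}|, #|{: T1}|) :=
  \matrix_(i < #|{: T2}|) ('X^(C - om2 (enum_val i : T2)) *: cl (mg (enum_val i : T2))).

Lemma bgen_phi t : size t = m2 ->
  bgen R m2 t *m phi = 'X^(C - om2 t) *: cl (mg t).
Proof.
by move=> st; rewrite -(seq_tupleE st) bgen_mul rowK enum_rankK.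
Qed.

(** The row of [t] encodes [t t^*] as the sum over its one-letter extensions, each traded for its
    last block by [cl_suffix]. *)
Lemma phi_rel (t : T2) : N (brow R m2 om2 t *m phi).
Proof.
have st : size t = m2 by rewrite size_tuple.
have sb e : size (behead (rcons t e)) = m2 by rewrite size_behead size_rcons st.
rewrite /brow mulmxBl bgen_phi // mulmx_suml.
have h1 : N (cl (mg t) - \sum_e cl (mg (rcons t e))).
  rewrite (mg_words hf (fr_nosink fr2) (fr_one fr2) t 1) sum_wordsS big_seq1.
  under eq_bigr => e _ do rewrite cats1.
  exact: bcls_sum.
have h2 : N (\sum_e cl (mg (rcons t e)) - \sum_(e | pth (rcons t e)) cl (mg (rcons t e))).
  rewrite (bigID (fun e => pth (rcons t e))) /= addrAC subrr add0r.
  apply: (N_sum N0 ND) => e /(mm_not_pth hf) ->; rewrite mul0r; exact: bcls0.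
apply: Ntr (Nsc _ (Ntr h1 h2)) _; rewrite scaler_sumr; apply: Nsum => e pe.
rewrite -scalemxAl bgen_phi //; set u := behead _.
apply: (bnull_sat (b := om2 u)); rewrite scalerBr !scalerA -!exprD.
have tle : (m2 <= size t)%N by rewrite st.
have sre : suffix_of m2 (rcons t e) = u by rewrite suffix_of_rcons // suffix_of_id.
have := @cl_suffix (rcons t e) _ pe; rewrite size_rcons st leqnSn sre => /(_ isT) h3.
have := Nsc 'X^(C - om2 t) h3; rewrite !scalerA -!exprD addnC.
have := ws_incr ws2 tle pe; have := om_le_C t; have := om_le_Cs (sb e).
rewrite -/u /bstep => l1 l2 l3.
suff -> : (om2 u + (om2 (rcons t e) - om2 t) + (C - om2 u) = C - om2 t + om2 (rcons t e))%N by [].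
by lia.
Qed.

(** The comparison of diagonals enters here: [t t^*] is a combination of [p p^*] for words [p] of
    the second family at a level at least [m2], and [cl_suffix] reduces these to blocks. *)
Lemma phi_surj (t : T1) : exists y,
  N (y *m phi - 'X^(C + om1 t) *: bgen R m1 t).
Proof.
have st : size t = m1 by rewrite size_tuple.
case: (boolP (pth t)) => [pt|npt]; last first.
  (* For a non-path the relation is the generator itself, which is therefore null. *)
  exists 0; rewrite mul0mx sub0r -scaleNr; apply: NZ.
  have := bnull_brow R om1 t; rewrite /brow big1 ?subr0 // => e pe.
  by move: pe; rewrite -cats1 => /pth_cat1; rewrite (negPf npt).
have [n0 /(diagonal_le fr2 (leq_addr m2 n0)) [c hc]] := diag12 t.
set n := (n0 + m2)%N in hc; have mn : (m2 <= n)%N by rewrite leq_addl.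
exists (\sum_(p <- words (edge E2) n | pth p)
  ((c p)%:P * 'X^(om2 p)) *: bgen R m2 (suffix_of m2 p)).
rewrite mulmx_suml.
apply: (@Ntr (\sum_(p <- words (edge E2) n | pth p) ((c p)%:P * 'X^C) *: cl (mg p))).
  rewrite big_seq_cond [X in _ - X]big_seq_cond; apply: Nsum => p.
  rewrite mem_words => /andP[/eqP sp pp].
  have mp : (m2 <= size p)%N by rewrite sp.
  have ss := size_suffix_of mp.
  rewrite -scalemxAl bgen_phi //.
  rewrite -!scalerA; apply: Nsc; rewrite scalerA -exprD.
  apply: (bnull_sat (b := om2 (suffix_of m2 p))); rewrite scalerBr !scalerA -!exprD.
  have := Nsym (Nsc 'X^C (cl_suffix mp pp)); rewrite !scalerA -!exprD.
  have := om_le_Cs ss => l1.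
  have -> : (om2 (suffix_of m2 p) + (om2 p + (C - om2 (suffix_of m2 p))) = C + om2 p)%N by lia.
  by rewrite (addnC _ C).
apply: (@Ntr ('X^C *: cl (mm X1 t * gg X1 t))); last first.
  rewrite exprD -scalerA; apply: Nsc.
  have mt : (m1 <= size t)%N by rewrite st.
  by have := bcls_mg fr1 ws1 mt pt; rewrite /bkap suffix_of_id.
under eq_bigr => p _ do rewrite mulrC -scalerA.
rewrite -scaler_sumr; apply: Nsc.
rewrite hc; apply: Nsym; apply: Ntr (bcls_sum _ _ _ _ _) _.
apply: (@Ntr (\sum_(p <- words (edge E2) n) (c p)%:P *: cl (mg p))).
  by apply: Nsum => p _; exact: bclsZ.
rewrite (bigID (fun p => pth p)) /= addrAC subrr add0r.
apply: (N_sum N0 ND) => p /(mm_not_pth hf) ->; rewrite mul0r; apply: NZ; exact: bcls0.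
Qed.

Lemma det_diag_X n (a : 'I_n -> nat) :
  exists b, \det (diag_mx (\row_i ('X^(a i) : {poly R}))) = 'X^b.
Proof.
exists (\sum_i a i)%N; rewrite det_diag (big_morph _ (@exprD _ 'X) (expr0 _)).
by apply: eq_bigr => i _; rewrite mxE.
Qed.

Lemma row_diag_mul n k (d : 'rV[{poly R}]_n) (A : 'M_(n, k)) i :
  row i (diag_mx d *m A) = d 0 i *: row i A.
Proof. by apply/rowP => j; rewrite mxE mul_diag_mx !mxE. Qed.

Theorem det_block_dvd : exists b w, 'X^b * \det Q2 = w * \det Q1.
Proof.
have /choice [az haz] : forall i : 'I_#|{: T2}|, exists az : nat * 'rV_#|{: T1}|,
    'X^(az.1) *: (row i Q2 *m phi) = az.2 *m Q1.
  move=> i; have [a [z h]] := phi_rel (enum_val i); exists (a, z) => /=.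
  by rewrite -h rowK.
have /choice [yb hyb] : forall i : 'I_#|{: T1}|, exists yb : 'rV_#|{: T2}| * (nat * 'rV_#|{: T1}|),
    'X^(yb.2.1) *: (yb.1 *m phi - 'X^(C + om1 (enum_val i : T1)) *: row i 1%:M) = yb.2.2 *m Q1.
  move=> i; have [y [b [z h]]] := phi_surj (enum_val i); exists (y, (b, z)) => /=.
  by rewrite -h rowE mulmx1 bgenE enum_valK.
(* Each row congruence holds after multiplication by its own power of ['X]; the diagonal matrices
   collect these powers and those in [phi_surj]. *)
pose Da := diag_mx (\row_i ('X^((az i).1) : {poly R})).
pose Db := diag_mx (\row_i ('X^((yb i).2.1) : {poly R})).
pose Dc := diag_mx (\row_(i < #|{: T1}|) ('X^(C + om1 (enum_val i : T1)) : {poly R})).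
have h1 : (Da *m Q2) *m phi = (\matrix_i (az i).2) *m Q1.
  apply/row_matrixP => i; rewrite [RHS]row_mul rowK -haz -mulmxA row_diag_mul row_mul.
  by rewrite mxE.
have h2 : (Db *m \matrix_i (yb i).1) *m phi - Db *m Dc = (\matrix_i (yb i).2.2) *m Q1.
  apply/row_matrixP => i; rewrite [RHS]row_mul rowK -hyb -mulmxA -mulmxBr row_diag_mul.
  by rewrite raddfB /= row_mul rowK -[Dc]mulmx1 row_diag_mul [in LHS]mxE [in LHS]mxE.
have [w] := det_fitting h1 h2; rewrite !det_mulmx.
have [a ->] := det_diag_X (fun i => (az i).1).
have [b ->] := det_diag_X (fun i => (yb i).2.1).
have [c ->] := det_diag_X (fun i : 'I_#|{: T1}| => (C + om1 (enum_val i : T1))%N).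
move=> e; exists (a + (b + c))%N, w; rewrite -e !exprD.
by rewrite mulrAC.
Qed.
End Core.

(** * Exchange of factors under the determinant; divisibility of polynomials with constant term 1 *)

Lemma det_1subC (S : comNzRingType) n k (A : 'M[S]_(n, k)) (B : 'M[S]_(k, n)) :
  \det (1%:M - A *m B) = \det (1%:M - B *m A).
Proof.
have e1 : block_mx 1%:M A B 1%:M = block_mx (1%:M - A *m B) A 0 1%:M *m block_mx 1%:M 0 B 1%:M.
  by rewrite mulmx_block !mulmx1 !mulmx0 ?mul0mx !mul1mx !add0r subrK.
have e2 : block_mx 1%:M A B 1%:M = block_mx 1%:M 0 B 1%:M *m block_mx 1%:M A 0 (1%:M - B *m A).
  by rewrite mulmx_block !mulmx1 !mulmx0 ?mul0mx !mul1mx !addr0 addrC subrK.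
have := congr1 determinant e1; rewrite e2 !det_mulmx !det_lblock !det_ublock !det1.
by rewrite !mulr1 !mul1r.
Qed.

Lemma coprimeX_dvd (R : comNzRingType) (P Q w : {poly R}) b : P`_0 = 1 ->
  'X^b * Q = w * P -> exists v, Q = v * P.
Proof.
move=> P0; elim: b w => [|b IHb] w; first by rewrite mul1r; exists w.
move=> e; have w0 : w`_0 = 0.
  have := congr1 (fun p : {poly R} => p`_0) e.
  by rewrite exprS -mulrA coefXM coef0M P0 mulr1.
have wE : w = drop_poly 1 w * 'X.
  rewrite -{1}(poly_take_drop 1 w) expr1 -[RHS]add0r; congr (_ + _).
  by apply/polyP => i; rewrite coef_take_poly coef0 ltnS leqn0; case: eqP => // ->.
apply: (IHb (drop_poly 1 w)); apply/polyP => i.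
have := congr1 (fun p : {poly R} => p`_i.+1) e.
rewrite exprS -mulrA coefXM /= => ->; rewrite {1}wE mulrAC coefMX //.
Qed.

Lemma dvd_antisym (R : comNzRingType) (P Q v w : {poly R}) :
  (forall a b : R, a * b = 0 -> a = 0 \/ b = 0) ->
  P`_0 = 1 -> Q`_0 = 1 -> Q = v * P -> P = w * Q -> P = Q.
Proof.
move=> dom P0 Q0 QE PE.
have reg (u : {poly R}) : u * P = 0 -> u = 0.
  move=> uP; apply/polyP => i; rewrite coef0; elim/ltn_ind: i => i IHi.
  have := congr1 (fun p : {poly R} => p`_i) uP.
  rewrite coefM coef0 big_ord_recr /= subnn P0 mulr1 big1 ?add0r // => j _.
  by rewrite IHi ?mul0r.
(* Thus [v] is a unit; leading coefficients force it to be constant, and its constant term is 1. *)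
have wv : w * v = 1.
  apply/eqP; rewrite -subr_eq0; apply/eqP/reg.
  by rewrite mulrBl -mulrA -QE -PE mul1r subrr.
have lc : lead_coef w * lead_coef v != 0.
  apply/eqP => /dom [] /eqP; rewrite lead_coef_eq0 => /eqP h; move: wv; rewrite h.
    by rewrite mul0r => /eqP; rewrite eq_sym oner_eq0.
  by rewrite mulr0 => /eqP; rewrite eq_sym oner_eq0.
have sv : (size v <= 1)%N.
  have := size_proper_mul lc; rewrite wv size_poly1.
  have : (0 < size w)%N.
    by rewrite lt0n size_poly_eq0; apply: contraNneq lc => ->; rewrite lead_coef0 mul0r.
  by lia.
have v0 : v`_0 = 1.
  by have := congr1 (fun p : {poly R} => p`_0) QE; rewrite coef0M Q0 P0 mulr1.
by rewrite QE (size1_polyC sv) v0 mul1r.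
Qed.

(** * Evaluation at one *)

Section HigherBlock.
Variable E : graph.
Local Notation T k := (k.-tuple (edge E)).

Lemma sum_enum_val (A : finType) (F : A -> int) :
  \sum_(i < #|{: A}|) F (enum_val i) = \sum_x F x.
Proof. by rewrite -(big_enum_val (A := mem {: A})); apply: eq_bigl => x; rewrite inE. Qed.

Definition block_entry (s t : seq (edge E)) : int :=
  \sum_(e | pth (rcons s e)) (t == behead (rcons s e))%:R.
Definition block_adj k : 'M[int]_#|{: T k}| :=
  \matrix_(i, j) block_entry (enum_val i : T k) (enum_val j : T k).

Definition ext_entry (s t : seq (edge E)) : int := \sum_e (pth t && (t == rcons s e))%:R.
Definition del_entry (t s : seq (edge E)) : int := (pth t && (s == behead t))%:R.

(** Elementary strong shift equivalence: appending a letter ([A]) and deleting the first one ([B])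
    factor the two matrices as [A B] and [B A]. *)
Lemma det_block_adjS k : (0 < k)%N ->
  \det (1%:M - block_adj k.+1) = \det (1%:M - block_adj k).
Proof.
move=> k0.
pose A : 'M[int]_(#|{: T k}|, #|{: T k.+1}|) :=
  \matrix_(i, j) ext_entry (enum_val i : T k) (enum_val j : T k.+1).
pose B : 'M[int]_(#|{: T k.+1}|, #|{: T k}|) :=
  \matrix_(i, j) del_entry (enum_val i : T k.+1) (enum_val j : T k).
have -> : block_adj k = A *m B.
  apply/matrixP => i j; rewrite !mxE; under eq_bigr do rewrite !mxE.
  rewrite (sum_enum_val (fun t : T k.+1 => ext_entry (enum_val i : T k) t *
    del_entry t (enum_val j : T k))) /block_entry.
  set s : T k := enum_val i; set s' : T k := enum_val j.
  rewrite /ext_entry; under [RHS]eq_bigr do rewrite mulr_suml.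
  rewrite exchange_big /= big_mkcond /=; apply: eq_bigr => e _.
  rewrite (bigD1 [tuple of rcons s e]) //= eqxx andbT /del_entry /=.
  rewrite big1 ?addr0 => [|t ts].
    by case: (pth _); rewrite ?mul1r ?mul0r.
  by rewrite -[RHS](mul0r (del_entry t s')) -val_eqE /= in ts *; rewrite (negPf ts) andbF.
have -> : block_adj k.+1 = B *m A; last exact: det_1subC.
apply/matrixP => i j; rewrite !mxE; under eq_bigr do rewrite !mxE.
rewrite (sum_enum_val (fun s : T k => del_entry (enum_val i : T k.+1) s *
  ext_entry s (enum_val j : T k.+1))).
set t : T k.+1 := enum_val i; set t' : T k.+1 := enum_val j.
rewrite (bigD1 [tuple of behead t]) //= big1 ?addr0 => [|s st]; last first.
  by rewrite /del_entry -val_eqE /= in st *; rewrite (negPf st) andbF mul0r.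
rewrite /del_entry eqxx andbT /ext_entry /block_entry mulr_sumr big_mkcond /=.
apply: eq_bigr => e _; case: t => -[|x t] //= ht.
(* Since [k > 0], a letter remains after the deletion; the two overlapping paths therefore glue to
   one. *)
have t0 : t != [::] by rewrite -size_eq0; move: ht; rewrite eqSS => /eqP ->; rewrite -lt0n.
case: (t' =P rcons t e :> seq _) => [->|_]; last by rewrite andbF mulr0 if_same.
rewrite andbT; case: t t0 {ht} => // y t _ /=; rewrite !rcons_path.
by case: (succ_edge x y); case: (path _ y t); case: (succ_edge _ e);
  rewrite ?mulr1 ?mulr0.
Qed.

(** Single edges give the edge graph of [E]; the source and range incidence matrices provide both
    factorizations. *)
Lemma det_block_adj1 : \det (1%:M - block_adj 1) = \det (1%:M - adjacency E).
Proof.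
pose A : 'M[int]_(nV E, #|{: T 1}|) := \matrix_(v, j) (src (thead (enum_val j : T 1)) == v)%:R.
pose B : 'M[int]_(#|{: T 1}|, nV E) := \matrix_(i, v) (rng (thead (enum_val i : T 1)) == v)%:R.
have -> : adjacency E = A *m B.
  apply/matrixP => v w; rewrite !mxE; under eq_bigr do rewrite !mxE.
  rewrite (sum_enum_val (fun t : T 1 => (src (thead t) == v)%:R * (rng (thead t) == w)%:R)).
  rewrite (reindex (fun e : edge E => [tuple e])) /=; last first.
    exists (@thead _ _) => [e _|t _]; first by rewrite theadE.
    by rewrite [RHS]tuple_eta; apply: val_inj => /=; case: t => -[|x []].
  rewrite -[LHS]natz -sum1_card natr_sum big_mkcond /=; apply: eq_bigr => e _.
  by rewrite theadE inE -natrM mulnb; case: (_ && _).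
have -> : block_adj 1 = B *m A; last exact: det_1subC.
apply/matrixP => i j; rewrite !mxE; under eq_bigr do rewrite !mxE.
set t : T 1 := enum_val i; set t' : T 1 := enum_val j.
have [x tE] : exists x, (t : seq _) = [:: x] by case: t => -[|x []] //=; exists x.
have [y tE'] : exists y, (t' : seq _) = [:: y] by case: t' => -[|y []] //=; exists y.
have -> : thead t = x by have := tuple_eta t => /(congr1 val) /=; rewrite tE => -[->].
have -> : thead t' = y by have := tuple_eta t' => /(congr1 val) /=; rewrite tE' => -[->].
rewrite (bigD1 (rng x)) //= eqxx mul1r big1 ?addr0 => [|v vx]; last first.
  by rewrite eq_sym (negPf vx) mul0r.
rewrite /block_entry tE tE' /= big_mkcond (bigD1 y) //= big1 ?addr0 => [|e ey].
  by rewrite eqxx andbT /succ_edge eq_sym; case: eqP.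
by case: ifP => // _; rewrite eqseq_cons andbT eq_sym (negPf ey).
Qed.

Lemma det_block_adj k : (0 < k)%N -> \det (1%:M - block_adj k) = \det (1%:M - adjacency E).
Proof.
case: k => // k _; elim: k => [|k IHk]; first exact: det_block_adj1.
by rewrite det_block_adjS.
Qed.
End HigherBlock.

Section BlockMatrixValues.
Variables (R : comNzRingType) (E : graph) (L : algType R) (X : LFamily E L).
Variables (G : grading L) (K m0 : nat) (om : seq (edge E) -> nat).
Hypothesis ws : weight_system X G K m0 om.
Local Notation T := (m0.-tuple (edge E)).

Lemma bmatE i j : bmat R m0 om i j = (i == j)%:R - \sum_(e | pth (rcons (enum_val i : T) e))
  'X^(bstep om (enum_val i : T) e) *
  ((enum_val j : T) == behead (rcons (enum_val i : T) e) :> seq _)%:R.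
Proof.
rewrite !mxE summxE val_eqE (inj_eq enum_val_inj) eq_sym; congr (_ - _).
by apply: eq_bigr => e _; rewrite !mxE.
Qed.

Lemma bstep_gt0 (t : T) e : pth (rcons t e) -> (0 < bstep om t e)%N.
Proof. by move=> pe; rewrite /bstep subn_gt0; apply: (ws_incr ws) => //; rewrite size_tuple. Qed.

(** All steps of the weight are positive, so the matrix becomes the identity at 0; the potential was
    introduced for this. *)
Lemma det_bmat_coef0 : (\det (bmat R m0 om))`_0 = 1.
Proof.
rewrite -horner_coef0 -/(horner_eval 0 _) -det_map_mx -[RHS](det1 _ #|{: T}|).
congr (\det _); apply/matrixP => i j; rewrite [LHS]mxE bmatE /= /horner_eval hornerD hornerN.
rewrite horner_sum big1 ?subr0 => [|e pe]; first by rewrite mxE; case: (i == j); rewrite !hornerE.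
by rewrite hornerM hornerXn expr0n eqn0Ngt bstep_gt0 // mul0r.
Qed.

Lemma det_bmat_at1 : (\det (bmat R m0 om)).[1] = (\det (1%:M - block_adj E m0))%:~R.
Proof.
rewrite -/(horner_eval 1 _) -det_map_mx -[RHS](det_map_mx intr).
congr (\det _); apply/matrixP => i j; rewrite [LHS]mxE bmatE /= /horner_eval hornerD hornerN.
rewrite horner_sum !mxE rmorphB /= rmorph_sum /=; congr (_ - _).
  by case: (i == j); rewrite !hornerE.
apply: eq_bigr => e _; rewrite hornerM hornerXn expr1n mul1r.
by case: (_ == _); rewrite !hornerE.
Qed.
End BlockMatrixValues.

(** * Transport along the star-isomorphism and conclusion *)

Section Transport.
Variables (R : comNzRingType) (E : graph) (A B : algType R) (X : LFamily E A).
Variables (stA : A -> A) (stB : B -> B) (psi : A -> B).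
Hypothesis hpsi : star_iso stA stB psi.

Definition push_family : LFamily E B :=
  LFam (fun v => psi (pv X v)) (fun e => psi (pe X e)) (fun e => psi (pg X e)).

Lemma push_LPA : is_Leavitt_path_algebra X -> is_Leavitt_path_algebra push_family.
Proof.
have [[psi' psiK psiK'] pD pZ pM _] := hpsi => -[[h1 h2 h3 h4 h5] hu].
have p0 : psi 0 = 0 by rewrite -(scale0r 0) pZ scale0r.
split.
  split=> /=.
  - by move=> v w; rewrite -pM h1; case: eqP.
  - by move=> e f; rewrite -pM h2; case: eqP.
  - by move=> e; rewrite -!pM; have [-> ->] := h3 e.
  - by move=> e; rewrite -!pM; have [-> ->] := h4 e.
  - move=> v /h5 ->; rewrite (big_morph psi pD p0).
    by apply: eq_bigr => e _; rewrite pM.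
move=> C Y hY; have [phi [[[fD fZ fM] fv fe fg] uphi]] := hu C Y hY.
have p'D x y : psi' (x + y) = psi' x + psi' y by rewrite -{1}(psiK' x) -{1}(psiK' y) -pD psiK.
have p'Z c x : psi' (c *: x) = c *: psi' x by rewrite -{1}(psiK' x) -pZ psiK.
have p'M x y : psi' (x * y) = psi' x * psi' y by rewrite -{1}(psiK' x) -{1}(psiK' y) -pM psiK.
exists (phi \o psi'); split.
  split=> /= *; rewrite ?psiK //.
  by split=> /= *; rewrite ?p'D ?p'Z ?p'M.
move=> chi [[cD cZ cM] cv ce cg]; apply: functional_extensionality_dep => b /=.
rewrite (uphi (chi \o psi)) /= ?psiK' //.
by split=> //=; split=> /= *; rewrite ?pD ?pZ ?pM.
Qed.

Lemma push_involution conjR : is_LPA_involution conjR X stA ->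
  is_LPA_involution conjR push_family stB.
Proof.
have [[psi' psiK psiK'] pD pZ pM pst] := hpsi => -[sD sZ sM sK [sv se]].
have stE b : stB b = psi (stA (psi' b)) by rewrite pst psiK'.
have p'D x y : psi' (x + y) = psi' x + psi' y by rewrite -{1}(psiK' x) -{1}(psiK' y) -pD psiK.
have p'Z c x : psi' (c *: x) = c *: psi' x by rewrite -{1}(psiK' x) -pZ psiK.
have p'M x y : psi' (x * y) = psi' x * psi' y by rewrite -{1}(psiK' x) -{1}(psiK' y) -pM psiK.
split=> [x y|c x|x y|x|]; rewrite ?stE ?p'D ?p'Z ?p'M ?sD ?sZ ?sM ?pD ?pZ ?pM //.
  by rewrite psiK sK psiK'.
by split=> [v|e] /=; rewrite -pst ?sv ?se.
Qed.
End Transport.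

Lemma det_adjacency_eq (R : comNzRingType) (E F : graph) (L : algType R)
  (X : LFamily E L) (Y : LFamily F L) (conjR : R -> R) (st : L -> L) :
  (forall a b : R, a * b = 0 -> a = 0 \/ b = 0) ->
  injective (fun z : int => z%:~R : R) ->
  essential E -> condition_L E -> essential F -> condition_L F ->
  is_Leavitt_path_algebra X -> is_LPA_involution conjR X st ->
  is_Leavitt_path_algebra Y -> is_LPA_involution conjR Y st ->
  (forall p : L, is_projection st p -> in_diagonal Y p) ->
  \det (1%:M - adjacency E) = \det (1%:M - adjacency F).
Proof.
move=> dom inj hE condE hF condF hX hstX hY hstY hproj.
have char0 n : (n%:R : R) = 0 -> n = 0%N.
  move=> h; have e : n%:Z%:~R = 0%:~R :> R by rewrite -pmulrn h.
  by have [] := inj _ _ e.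
have [frX] := frame_exists (fun v => proj1 (hE v)) hX.
have [frY] := frame_exists (fun v => proj1 (hF v)) hY.
have [M hM] := edge_weights dom hstX frX frY condE hproj.
have [K [om [K0 wsY]]] :=
  cross_weight_system dom char0 hstX hstY frY condE condF hproj hM.
(* Both weight systems refer to the grading by [E] and share the scale [K], as the comparison in
   either direction requires. *)
have wsX := own_weight_system frX K0.
have [b [w hw]] := det_block_dvd frX frY wsX wsY (mgX_diagonal hstX frX frY hproj).
have [b' [w' hw']] := det_block_dvd frY frX wsY wsX
  (fun p => diagonal_YX hstX frX frY condE hproj (diagonal_mg Y p)).
have dX0 := det_bmat_coef0 wsX; have dY0 := det_bmat_coef0 wsY.
have [v hv] := coprimeX_dvd dX0 hw; have [v' hv'] := coprimeX_dvd dY0 hw'.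
have dE := dvd_antisym dom dX0 dY0 hv hv'.
rewrite -(@det_block_adj E 1) // -(@det_block_adj F M.+1) //.
by apply: inj; have := congr1 (fun p : {poly R} => p.[1]) dE; rewrite /= !det_bmat_at1.
Qed.

Theorem theorem6p3
  (E F : graph)
  (hE_ess : essential E) (hE_sc : strongly_connected E) (hE_L : condition_L E)
  (hF_ess : essential F) (hF_sc : strongly_connected F) (hF_L : condition_L F)
  (R : comNzRingType) (iota : R -> cpx) (conjR : R -> R)
  (hR : conj_closed_subring_of_C iota conjR)
  (LE : algType R) (XE : LFamily E LE) (stE : LE -> LE)
  (hLE : is_Leavitt_path_algebra XE) (hstE : is_LPA_involution conjR XE stE)
  (LF : algType R) (XF : LFamily F LF) (stF : LF -> LF)
  (hLF : is_Leavitt_path_algebra XF) (hstF : is_LPA_involution conjR XF stF)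
  (hproj : forall p : LF, is_projection stF p -> in_diagonal XF p)
  (hiso : exists psi : LE -> LF, star_iso stE stF psi) :
  Num.sg (\det (1%:M - adjacency E)) = Num.sg (\det (1%:M - adjacency F)).
Proof.
have [psi hpsi] := hiso; congr (Num.sg _).
apply: (det_adjacency_eq (subring_domain hR) (subring_intr_inj hR) hE_ess hE_L hF_ess hF_L
  (push_LPA hpsi hLE) (push_involution hpsi hstE) hLF hstF hproj).
Qed.
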